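(* Let $\mathfrak{g}$ be a Lie ring definable in a finite-dimensional theory. Let $\mathfrak{i}$ be a definable ideal of $\mathfrak{g}$ and let $\mathfrak{c}$ be a definable almost Cartan subring of $\mathfrak{i}$. Then $\mathfrak{g}\sim \mathfrak{i}+\widetilde{N}_{\mathfrak{g}}(\mathfrak{c})$.
   Context: Finite-dimensional theory: a first-order theory $T$ with a function $\dim$ from the class of all interpretable sets in models of $T$ to $\omega\cup\{-\infty\}$ such that, for every formula $\phi(x,y)$, all interpretable sets $X,Y$ and every interpretable function $f:X\to Y$: (Invariance) if $a,a'$ have the same type over $\emptyset$ then $\dim\phi(x,a)=\dim\phi(x,a')$; (Algebraicity) $\dim\emptyset=-\infty$, and $\dim X=0$ iff $X$ is finite (nonempty); (Union) $\dim(X\cup Y)=\max\{\dim X,\dim Y\}$; (Upper Fibration) if $\dim f^{-1}(y)\ge k$ for all $y\in Y$ then $\dim X\ge\dim Y+k$; (Lower Fibration) if $\dim f^{-1}(y)\le k$ for all $y\in Y$ then $\dim X\le \dim Y+k$. An object is definable in a finite-dimensional theory if it is definable in a model of such a theory. Lie ring: an abelian group $(\mathfrak{g},+)$ with a bilinear, antisymmetric bracket satisfying the Jacobi identity. A Lie subring is a subgroup closed under the bracket; an ideal is a subgroup $\mathfrak i$ with $[g,\mathfrak i]\le\mathfrak i$ for all $g\in\mathfrak g$. A Lie ring is nilpotent if it has a chain of ideals $\mathfrak g=\mathfrak g_0\ge\dots\ge\mathfrak g_n=0$ with $[\mathfrak g,\mathfrak g_i]\le\mathfrak g_{i+1}$;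 it is virtually nilpotent if it has a nilpotent Lie subring of finite index. For subgroups $H,K$ of a group, $H$ is almost contained in $K$ if $H\cap K$ has finite index in $H$; $H\sim K$ (commensurable) means that each of $H,K$ is almost contained in the other. For a subgroup $H\le\mathfrak g$, the almost normaliser is $\widetilde N_{\mathfrak g}(H)=\{g\in\mathfrak g: [g,H]\text{ is almost contained in }H\}$, where $[g,H]=\{[g,h]:h\in H\}$. A Lie subring $\mathfrak c$ of a Lie ring $\mathfrak i$ is an almost Cartan subring of $\mathfrak i$ if $\mathfrak c$ is virtually nilpotent and has finite index in $\widetilde N_{\mathfrak i}(\mathfrak c)$. *)

(* Defs.v *)
From HB Require Import structures.
From mathcomp Require Import all_boot all_order all_algebra.
From mathcomp Require Import all_classical.

Set Implicit Arguments.
Unset Strict Implicit.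
Unset Printing Implicit Defensive.

Import GRing.Theory.
Local Open Scope classical_set_scope.
Local Open Scope ring_scope.

Record language := Language {
  fun_symbol : Type;
  fun_arity : fun_symbol -> nat;
  rel_symbol : Type;
  rel_arity : rel_symbol -> nat
}.

(* Terms and formulas are well scoped: [formula L n] has its free variables
   among n de Bruijn indices, and [FAll] binds index 0. *)
Inductive term (L : language) (n : nat) : Type :=
| TVar (i : 'I_n)
| TFun (f : fun_symbol L) (args : 'I_(fun_arity f) -> term L n).

Inductive formula (L : language) : nat -> Type :=
| FFalse n : formula L n
| FEq n : term L n -> term L n -> formula L n
| FRel n (r : rel_symbol L) : ('I_(rel_arity r) -> term L n) -> formula L n
| FImp n : formula L n -> formula L n -> formula L n
| FAll n : formula L n.+1 -> formula L n.

Definition theory (L : language) := set (formula L 0).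

Record structure (L : language) := Structure {
  carrier :> Type;
  carrier_inhabited : inhabited carrier;
  fun_interp : forall f : fun_symbol L, (fun_arity f).-tuple carrier -> carrier;
  rel_interp : forall r : rel_symbol L, (rel_arity r).-tuple carrier -> Prop
}.

Fixpoint eval (L : language) (M : structure L) n (e : n.-tuple M)
    (t : term L n) : M :=
  match t with
  | TVar i => tnth e i
  | TFun f args => fun_interp [tuple eval e (args i) | i < fun_arity f]
  end.

Fixpoint sat (L : language) (M : structure L) n (phi : formula L n) :
    n.-tuple M -> Prop :=
  match phi in formula _ n return n.-tuple M -> Prop with
  | FFalse _ => fun _ => False
  | FEq _ s t => fun e => eval e s = eval e t
  | FRel _ r args => fun e => rel_interp [tuple eval e (args i) | i < rel_arity r]
  | FImp _ phi psi => fun e => sat phi e -> sat psi e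
  | FAll _ phi => fun e => forall a : M, sat phi [tuple of a :: e]
  end.

Definition models (L : language) (M : structure L) (T : theory L) : Prop :=
  forall phi, T phi -> sat (M := M) phi [tuple].

Definition same_type (L : language) (M M' : structure L) m
    (a : m.-tuple M) (a' : m.-tuple M') : Prop :=
  forall phi : formula L m, sat phi a <-> sat phi a'.

Definition sol_set (L : language) (M : structure L) n m
    (phi : formula L (n + m)) (a : m.-tuple M) : set (n.-tuple M) :=
  [set x : n.-tuple M | sat phi [tuple of x ++ a]].

Definition sol_rel (L : language) (M : structure L) n m
    (phi : formula L (n + (n + m))) (a : m.-tuple M) :
    n.-tuple M -> n.-tuple M -> Prop :=
  fun x y => sat phi [tuple of x ++ [tuple of y ++ a]].

(* Definability is always with parameters. *)
Definition definable (L : language) (M : structure L) n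
    (D : set (n.-tuple M)) : Prop :=
  exists m (phi : formula L (n + m)) (a : m.-tuple M), D = sol_set phi a.

Definition equivalence_on (U : Type) (D : set U) (E : U -> U -> Prop) : Prop :=
  [/\ forall x, D x -> E x x,
      forall x y, D x -> D y -> E x y -> E y x &
      forall x y z, D x -> D y -> D z -> E x y -> E y z -> E x z].

(* The quotient D / E, as the set of its equivalence classes. *)
Definition quotient_set (U : Type) (D : set U) (E : U -> U -> Prop) :
    set (set U) :=
  [set [set y | D y /\ E x y] | x in D].

(* An interpretable set is a set of classes X of n-tuples; a definable set
   occurs among these as the set of its singletons (E being equality). *)
Definition interpretable (L : language) (M : structure L) n
    (X : set (set (n.-tuple M))) : Prop :=
  exists m (delta : formula L (n + m)) (eps : formula L (n + (n + m)))
      (a : m.-tuple M),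
    equivalence_on (sol_set delta a) (sol_rel eps a) /\
    X = quotient_set (sol_set delta a) (sol_rel eps a).

Definition interpretable_fun (L : language) (M : structure L) n p
    (X : set (set (n.-tuple M))) (Y : set (set (p.-tuple M)))
    (f : set (n.-tuple M) -> set (p.-tuple M)) : Prop :=
  (forall u, X u -> Y (f u)) /\
  definable [set [tuple of xy.1 ++ xy.2] | xy in
    [set xy : n.-tuple M * p.-tuple M | exists u, [/\ X u, u xy.1 & f u xy.2]]].

(* Dimensions live in omega + {-oo}; [None] stands for -oo. *)
Definition dimension := option nat.

Definition dim_le (d e : dimension) : Prop :=
  match d, e with
  | None, _ => True
  | Some _, None => False
  | Some a, Some b => (a <= b)%N
  end.

Definition dim_max (d e : dimension) : dimension :=
  match d, e with
  | None, _ => e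
  | _, None => d
  | Some a, Some b => Some (maxn a b)
  end.

Definition dim_add (d : dimension) (k : nat) : dimension :=
  omap (fun a => (a + k)%N) d.

(* The values of dim outside the interpretable sets of models of T are
   irrelevant.  In [dim_invariance] the parameters a and a' may lie in different
   models of T, so that in particular dim is preserved in elementary
   extensions. *)
Record dimension_function (L : language) (T : theory L)
    (dim : forall (M : structure L) n, set (set (n.-tuple M)) -> dimension) :
    Prop := DimensionFunction {
  dim_invariance : forall (M M' : structure L), models M T -> models M' T ->
    forall n m (delta : formula L (n + m)) (eps : formula L (n + (n + m)))
      (a : m.-tuple M) (a' : m.-tuple M'),
    same_type a a' ->
    equivalence_on (sol_set delta a) (sol_rel eps a) ->
    dim M n (quotient_set (sol_set delta a) (sol_rel eps a)) =
    dim M' n (quotient_set (sol_set delta a') (sol_rel eps a'));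
  dim_empty : forall M : structure L, models M T ->
    forall n, dim M n set0 = None;
  dim_finite : forall M : structure L, models M T ->
    forall n (X : set (set (n.-tuple M))), interpretable X ->
    (dim M n X = Some 0%N <-> finite_set X /\ X !=set0);
  dim_union : forall M : structure L, models M T ->
    forall n (X Y : set (set (n.-tuple M))),
    interpretable X -> interpretable Y -> interpretable (X `|` Y) ->
    dim M n (X `|` Y) = dim_max (dim M n X) (dim M n Y);
  dim_upper_fibration : forall M : structure L, models M T ->
    forall n p (X : set (set (n.-tuple M))) (Y : set (set (p.-tuple M)))
      (f : set (n.-tuple M) -> set (p.-tuple M)) (k : nat),
    interpretable X -> interpretable Y -> interpretable_fun X Y f ->
    (forall v, Y v -> dim_le (Some k) (dim M n (X `&` f @^-1` [set v]))) ->
    dim_le (dim_add (dim M p Y) k) (dim M n X);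
  dim_lower_fibration : forall M : structure L, models M T ->
    forall n p (X : set (set (n.-tuple M))) (Y : set (set (p.-tuple M)))
      (f : set (n.-tuple M) -> set (p.-tuple M)) (k : nat),
    interpretable X -> interpretable Y -> interpretable_fun X Y f ->
    (forall v, Y v -> dim_le (dim M n (X `&` f @^-1` [set v])) (Some k)) ->
    dim_le (dim M n X) (dim_add (dim M p Y) k)
}.

Definition finite_dimensional (L : language) (T : theory L) : Prop :=
  exists dim, @dimension_function L T dim.

(* [x, x] = 0 is not required: the bracket is only antisymmetric. *)
HB.mixin Record isLieRing V of GRing.Zmodule V := {
  bracket : V -> V -> V;
  bracketDl : left_distributive bracket +%R;
  bracketDr : right_distributive bracket +%R;
  bracketC : forall x y, bracket x y = - bracket y x;
  bracket_jacobi : forall x y z,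
    bracket x (bracket y z) + bracket y (bracket z x) +
    bracket z (bracket x y) = 0
}.

#[short(type="lieRingType")]
HB.structure Definition LieRing := {V of isLieRing V & GRing.Zmodule V}.

Definition subgroup (V : zmodType) (H : set V) : Prop :=
  H 0 /\ forall x y, H x -> H y -> H (x - y).

Definition lie_subring (g : lieRingType) (H : set g) : Prop :=
  subgroup H /\ forall x y, H x -> H y -> H (bracket x y).

Definition ideal_of (g : lieRingType) (A I : set g) : Prop :=
  [/\ I `<=` A, subgroup I & forall x y, A x -> I y -> I (bracket x y)].

Definition nilpotent (g : lieRingType) (A : set g) : Prop :=
  exists n (C : nat -> set g),
    [/\ C 0%N = A, C n = [set 0],
        forall k, (k <= n)%N -> ideal_of A (C k) &
        forall k, (k < n)%N -> C k.+1 `<=` C k /\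
          forall x y, A x -> C k y -> C k.+1 (bracket x y)].

Definition coset (V : zmodType) (x : V) (K : set V) : set V :=
  [set x + k | k in K].

Definition finite_index (V : zmodType) (K H : set V) : Prop :=
  K `<=` H /\ finite_set [set coset x K | x in H].

Definition virtually_nilpotent (g : lieRingType) (A : set g) : Prop :=
  exists N, [/\ lie_subring N, nilpotent N & finite_index N A].

Definition almost_contained (V : zmodType) (H K : set V) : Prop :=
  finite_index (H `&` K) H.

Definition commensurable (V : zmodType) (H K : set V) : Prop :=
  almost_contained H K /\ almost_contained K H.

Definition almost_normaliser (g : lieRingType) (A H : set g) : set g :=
  [set x | A x /\ almost_contained [set bracket x h | h in H] H].

Definition almost_cartan (g : lieRingType) (I C : set g) : Prop :=
  [/\ C `<=` I, lie_subring C, virtually_nilpotent C &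
      finite_index C (almost_normaliser I C)].

(* g is a Lie ring definable in M through the coordinates iota: its carrier is
   identified with the definable set [range iota] of n-tuples. *)
Definition definable_lie_ring (L : language) (M : structure L)
    (g : lieRingType) n (iota : g -> n.-tuple M) : Prop :=
  [/\ injective iota,
      definable (range iota),
      definable [set [tuple of iota xy.1 ++ [tuple of
        iota xy.2 ++ iota (xy.1 + xy.2)]] | xy in [set: g * g]] &
      definable [set [tuple of iota xy.1 ++ [tuple of
        iota xy.2 ++ iota (bracket xy.1 xy.2)]] | xy in [set: g * g]]].

(* Main.v *)
(** Proof idea.  Work with subgroups up to finite index, dimension serving as a
    rank on definable ones.  Let N be a nilpotent subring of finite index in c.

    Among the definable subgroups E, almost invariant under ad(N), such that
    i + E has finite index in g, take one of minimal dimension.  For h in N, a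
    Fitting decomposition of E with respect to ad(h) shows that the intersection
    of E with ker ad(h)^k is again such a subgroup for large k, so that ad(h) is
    almost nilpotent on E.  An Engel-type descent along a central series of N then
    gives that E /\ i is almost contained in c: otherwise some definable W with
    c <= W <= i, not almost contained in c, satisfies [h, W] almost contained in c
    for every h in N, and W is almost contained in the almost normaliser of c in
    i, hence in c.  Finally [h, E] is almost contained in E /\ i, hence in c, so
    that E is almost contained in the almost normaliser of c in g.

    Both times one passes from "for each h in N, almost every w has [h, w] in c"
    to "for almost every w, almost every h in N has [h, w] in c".  This
    follows from Neumann's covering lemma once the indices of the subgroups
    { w | [h, w] in c } are bounded uniformly in h.  The bound comes from
    compactness: unbounded indices would give, in an ultrapower of M, arbitrarily
    long chains of definable subgroups each of infinite index in the preceding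
    one, along which the dimension would have to drop. *)

Require Import Defs.
From HB Require Import structures.
From mathcomp Require Import all_boot all_order all_algebra.
From mathcomp Require Import all_classical.
Import GRing.Theory.
Local Open Scope classical_set_scope.
Local Open Scope ring_scope.
Set Implicit Arguments.
Unset Strict Implicit.
Unset Printing Implicit Defensive.

(** * Almost containment of subgroups *)

(* Finitely many translates of B cover A.  For subgroups this is
   [almost_contained], by [almost_containedP] below; as no subgroup structure is
   involved, transitivity and images are immediate. *)
Definition acont (V : zmodType) (A B : set V) : Prop :=
  exists s : seq V, forall a, A a -> exists2 x, x \in s & B (a - x).

Definition sumset (V : zmodType) (A B : set V) : set V :=
  [set x + y | x in A & y in B].

(** Pigeonhole form of index at most [d]: two of the first [d.+1] terms of any sequence are
    congruent. The sequence can be fixed before [K], as [bilinear_symmetry] does. *)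
Definition index_le (V : zmodType) (d : nat) (K H : set V) : Prop :=
  forall x : nat -> V, (forall j, H (x j)) ->
  exists j l, [/\ (j < l)%N, (l <= d)%N & K (x l - x j)].

Section AlmostContainment.
Variable V : zmodType.
Implicit Types A B C H K : set V.

Lemma subgroup0 H : subgroup H -> H 0. Proof. by case. Qed.

Lemma subgroupB H x y : subgroup H -> H x -> H y -> H (x - y).
Proof. by case=> _; apply. Qed.

Lemma subgroupN H x : subgroup H -> H x -> H (- x).
Proof. by move=> HH Hx; rewrite -sub0r; apply: subgroupB => //; case: HH. Qed.

Lemma subgroupD H x y : subgroup H -> H x -> H y -> H (x + y).
Proof.
by move=> HH Hx Hy; rewrite -[y]opprK; apply: subgroupB => //; apply: subgroupN.
Qed.

Lemma subgroupI H K : subgroup H -> subgroup K -> subgroup (H `&` K).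
Proof.
move=> HH HK; split; first by split; apply: subgroup0.
by move=> x y [? ?] [? ?]; split; apply: subgroupB.
Qed.

Lemma subgroup_sum H K : subgroup H -> subgroup K -> subgroup (sumset H K).
Proof.
move=> HH HK; split.
  by exists 0; [exact: subgroup0|exists 0; [exact: subgroup0|rewrite addr0]].
move=> _ _ [x Hx [y Ky <-]] [x' Hx' [y' Ky' <-]].
exists (x - x'); first exact: subgroupB.
by exists (y - y'); [exact: subgroupB|rewrite opprD addrACA].
Qed.

Lemma subset_sumr H K : subgroup H -> K `<=` sumset H K.
Proof. by move=> HH x Kx; exists 0; [case: HH|exists x; rewrite ?add0r]. Qed.

Lemma subset_suml H K : subgroup K -> H `<=` sumset H K.
Proof. by move=> HK x Hx; exists x => //; exists 0; [case: HK|rewrite addr0]. Qed.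

Lemma acont_sub A B : A `<=` B -> acont A B.
Proof. by move=> AB; exists [:: 0] => a /AB Ba; exists 0; rewrite ?inE ?subr0. Qed.

Lemma acont_trans A B C : acont A B -> acont B C -> acont A C.
Proof.
move=> [s sP] [t tP]; exists [seq x + y | x <- s, y <- t] => a /sP[x xs /tP[y yt Cy]].
by exists (x + y); [exact: allpairs_f|rewrite opprD addrA].
Qed.

Lemma acont_sum A B C : subgroup C -> acont A C -> acont B C -> acont (sumset A B) C.
Proof.
move=> HC [s sP] [t tP]; exists [seq x + y | x <- s, y <- t].
move=> _ [a /sP[x xs Cx] [b /tP[y yt Cy] <-]].
by exists (x + y); [exact: allpairs_f|rewrite opprD addrACA; apply: subgroupD].
Qed.

Lemma acont_sumS A B C : acont A B -> acont (sumset C A) (sumset C B).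
Proof.
move=> [s sP]; exists s => _ [c Cc [a /sP[x xs Bx] <-]]; exists x => //.
by exists c => //; exists (a - x) => //; rewrite addrA.
Qed.

(* The translating elements are picked inside A, one per nonempty class [P k]. *)
Lemma acont_key (K : eqType) (P : K -> V -> Prop) (s : seq K) A B :
  (forall a, A a -> exists2 k, k \in s & P k a) ->
  (forall k a a', A a -> A a' -> P k a -> P k a' -> B (a - a')) ->
  acont A B.
Proof.
move=> sP PB.
have /choice[r rP] : forall k, exists a', (exists a, A a /\ P k a) -> A a' /\ P k a'.
  by move=> k; have [[a ?]|n] := pselect (exists a, A a /\ P k a); [exists a|exists 0].
exists (map r s) => a Aa; have [k ks Pk] := sP a Aa.
have [|Ar Pr] := rP k; first by exists a.
by exists (r k); [exact: map_f|apply: PB Pk Pr].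
Qed.

Lemma acontI A B C : subgroup B -> subgroup C ->
  acont A B -> acont A C -> acont A (B `&` C).
Proof.
move=> HB HC [s sP] [t tP].
apply: (@acont_key _ (fun k a => B (a - k.1) /\ C (a - k.2)) [seq (x, y) | x <- s, y <- t]).
  move=> a Aa; have [x xs Bx] := sP a Aa; have [y yt Cy] := tP a Aa.
  by exists (x, y) => //; exact: allpairs_f.
move=> [x y] a a' _ _ /= [Bx Cy] [Bx' Cy']; split.
  by rewrite -(subrKA x) -[x - a']opprB; apply: subgroupB.
by rewrite -(subrKA y) -[y - a']opprB; apply: subgroupB.
Qed.

Lemma acont_self A B : subgroup A -> subgroup B -> acont A B -> acont A (A `&` B).
Proof. by move=> HA HB AB; apply: acontI => //; apply: acont_sub. Qed.

Lemma finite_index_acont H K : K 0 -> finite_index K H -> acont H K.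
Proof.
move=> K0 [_ /finite_seqP[s sE]].
apply: (@acont_key _ (fun C a => coset a K = C) s).
  move=> a Ha; exists (coset a K) => //.
  have : [set coset x K | x in H] (coset a K) by exists a.
  by rewrite sE.
move=> _ a a' _ _ /[swap] <- E.
have : coset a K a by exists 0; rewrite ?addr0.
by rewrite E => -[k Kk <-]; rewrite addrAC subrr add0r.
Qed.

Lemma acont_finite_index H K : subgroup K -> K `<=` H -> acont H K -> finite_index K H.
Proof.
move=> HK KH [s sP]; split=> //.
apply: (@sub_finite_set _ _ ((fun x => coset x K) @` [set` s])); last first.
  by apply: finite_image; apply/finite_seqP; exists s.
move=> _ [a Ha <-]; have [x xs Kx] := sP a Ha; exists x => //.
apply/seteqP; split=> y [k Kk <-].
  exists (- (a - x) + k); first by apply: subgroupD => //; apply: subgroupN.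
  by rewrite opprB addrA (addrC a) subrK.
exists (a - x + k); first exact: subgroupD.
by rewrite addrA (addrC x) subrK.
Qed.

Lemma almost_containedP H K : subgroup H -> subgroup K ->
  almost_contained H K <-> acont H K.
Proof.
move=> HH HK; split=> [HKf|].
  apply: (@acont_trans _ (H `&` K)); last by apply: acont_sub => x [].
  by apply: finite_index_acont HKf; split; apply: subgroup0.
move=> HKa; apply: acont_finite_index; [exact: subgroupI|by move=> x []|exact: acont_self].
Qed.

(** Greedy choice: the translates of [B] by the terms already chosen miss a point of [A], which
    becomes the next term. *)
Lemma not_acont_seq A B : ~ acont A B ->
  exists x : nat -> V, (forall j, A (x j)) /\ forall j l, (j < l)%N -> ~ B (x l - x j).
Proof.
move=> nAB.
have /choice[r rP] : forall s : seq V, exists a, A a /\ forall x, x \in s -> ~ B (a - x).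
  move=> s; apply: contrapT => nex; apply: nAB; exists s => a Aa.
  apply: contrapT => n2; apply: nex; exists a; split=> // x xs Bx.
  by apply: n2; exists x.
pose L := fix L n := if n is m.+1 then r (L m) :: L m else [::].
have Lmem j l : (j < l)%N -> r (L j) \in L l.
  elim: l => // l IH; rewrite ltnS leq_eqVlt => /orP[/eqP->|/IH]; rewrite /= inE ?eqxx //.
  by move->; rewrite orbT.
exists (fun n => r (L n)); split=> [j|j l jl]; first by case: (rP (L j)).
by case: (rP (L l)) => _; apply; apply: Lmem.
Qed.

Lemma acont_index_le H K : subgroup K -> acont H K -> exists d, index_le d K H.
Proof.
move=> HK [s sP]; exists (size s) => x Hx.
have /choice[r rP] : forall j, exists y, y \in s /\ K (x j - y).
  by move=> j; have [y ys Ky] := sP _ (Hx j); exists y.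
have : ~~ uniq (map r (iota 0 (size s).+1)).
  apply: contraT => /negPn /uniq_leq_size; rewrite size_map size_iota.
  by move=> /(_ s); rewrite ltnn => ->// _ /mapP[j _ ->]; case: (rP j).
move=> /(uniqPn 0)[j [l [jl]]]; rewrite size_map size_iota => ls.
rewrite !(nth_map 0%N) ?size_iota ?(ltn_trans jl) // !nth_iota ?(ltn_trans jl) // !add0n => E.
exists j, l; split=> //; have [_ Kj] := rP j; have [_ Kl] := rP l.
by rewrite -(subrKA (r l)) -[r l - x j]opprB -E; apply: subgroupB; rewrite // E.
Qed.

(* B. H. Neumann's lemma on coverings by cosets. *)
Lemma neumann_covering (I : eqType) (Q : I -> set V) (r : seq I) (s : seq V) H :
  subgroup H -> (forall i, subgroup (Q i)) ->
  (forall a, H a -> exists2 i, i \in r & exists2 x, x \in s & Q i (a - x)) ->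
  exists2 i, i \in r & acont H (Q i).
Proof.
move=> HH HQ; elim: r s => [|i r IH] s cov.
  by have [] := cov 0 (subgroup0 HH).
have [[z [Hz nz]]|all_i] := pselect (exists z, H z /\ forall x, x \in s -> ~ Q i (z - x)); last first.
  exists i; first exact: mem_head.
  exists s => a Ha; apply: contrapT => n2; apply: all_i; exists a; split=> // x xs Qx.
  by apply: n2; exists x.
have /choice[t tP] : forall x, exists a', (exists a, H a /\ Q i (a - x)) -> H a' /\ Q i (a' - x).
  by move=> x; have [[a ?]|n] := pselect (exists a, H a /\ Q i (a - x)); [exists a|exists 0].
case: (IH (s ++ [seq y - z + t x | x <- s, y <- s])) => [a Ha|j jr Hj]; last first.
  by exists j => //; rewrite inE jr orbT.
have [j] := cov a Ha; rewrite inE => /orP[/eqP->|jr] [x xs Qx]; last first.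
  by exists j => //; exists x => //; rewrite mem_cat xs.
have [|Ht Qt] := tP x; first by exists a.
have Qat : Q i (a - t x) by rewrite -(subrKA x) -[x - t x]opprB; apply: subgroupB.
have [|k] := cov (z + (a - t x)).
  by apply: subgroupD => //; apply: subgroupB.
rewrite inE => /orP[/eqP->|kr] [y ys Qy].
  case: (nz y ys); rewrite -[z](addrK (a - t x)) addrAC; exact: subgroupB.
exists k => //; exists (y - z + t x); first by rewrite mem_cat (allpairs_f (fun x y => y - z + t x)) ?orbT.
suff -> : a - (y - z + t x) = z + (a - t x) - y by [].
by rewrite opprD opprB addrCA addrAC.
Qed.

End AlmostContainment.

Lemma acont_image (V V' : zmodType) (f : V -> V') (A B : set V) :
  {morph f : x y / x - y} -> acont A B -> acont (f @` A) (f @` B).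
Proof.
move=> fB [s sP]; exists (map f s) => _ [a /sP[x xs Bx] <-].
by exists (f x); [exact: map_f|exists (a - x)].
Qed.

Lemma acont_preimage (V V' : zmodType) (f : V -> V') (A : set V) (B : set V') :
  {morph f : x y / x - y} -> subgroup B ->
  acont (f @` A) B -> acont A (f @^-1` B).
Proof.
move=> fB HB [s sP]; apply: (@acont_key _ _ (fun k a => B (f a - k)) s).
  by move=> a Aa; apply: sP; exists a.
move=> x a a' _ _ Bx Bx'; rewrite /preimage /= fB -(subrKA x) -[x - f a']opprB.
exact: subgroupB.
Qed.

Lemma subgroup_image (V V' : zmodType) (f : V -> V') (A : set V) :
  {morph f : x y / x - y} -> subgroup A -> subgroup (f @` A).
Proof.
move=> fB HA; split; first by exists 0; [case: HA|rewrite -[X in f X](subrr 0) fB subrr].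
by move=> _ _ [x Ax <-] [y Ay <-]; exists (x - y); rewrite ?fB //; apply: subgroupB.
Qed.

Lemma subgroup_preimage (V V' : zmodType) (f : V -> V') (B : set V') :
  {morph f : x y / x - y} -> subgroup B -> subgroup (f @^-1` B).
Proof.
move=> fB HB; split.
  by rewrite /preimage /= -[X in f X](subrr 0) fB subrr; case: HB.
by move=> x y Bx By; rewrite /preimage /= fB; apply: subgroupB.
Qed.

(** * The Frattini argument for Lie rings with a rank *)

Lemma exists_min_nat (T : Type) (P : T -> Prop) (f : T -> nat) :
  (exists x, P x) -> exists x, P x /\ forall y, P y -> (f x <= f y)%N.
Proof.
move=> [x Px].
have [k] := ubnP (f x); elim: k x Px => // k IH x Px fx.
have [[y [Py yx]]|nex] := pselect (exists y, P y /\ (f y < f x)%N).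
  by apply: (IH y) => //; apply: leq_trans yx _.
by exists x; split=> // y Py; rewrite leqNgt; apply/negP => yx; apply: nex; exists y.
Qed.

Lemma nonincreasing_stable (u : nat -> nat) : (forall k, (u k.+1 <= u k)%N) ->
  exists k0, forall k, (k0 <= k)%N -> u k = u k0.
Proof.
move=> u_dec.
have [//|k0 [_ k0min]] := @exists_min_nat _ (fun _ => True) u; first by exists 0%N.
exists k0 => k k0k; apply/eqP; rewrite eqn_leq k0min // andbT.
rewrite -(subnK k0k); elim: (k - k0)%N => // m IH.
exact: leq_trans (u_dec _) IH.
Qed.

(** * Bracket identities and iterated adjoint maps *)

Section Brackets.
Variable g : lieRingType.
Implicit Types x y z : g.

Lemma bracketBr x : {morph bracket x : y z / y - z}.
Proof.
move=> y z; apply: (addIr (bracket x z)).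
by rewrite -bracketDr !subrK.
Qed.

Lemma bracketx0 x : bracket x 0 = 0.
Proof. by rewrite -[X in bracket _ X](subrr 0) bracketBr subrr. Qed.

Lemma bracket0x x : bracket 0 x = 0.
Proof. by rewrite bracketC bracketx0 oppr0. Qed.

Lemma bracketBl x y z : bracket (x - y) z = bracket x z - bracket y z.
Proof. by rewrite bracketC bracketBr opprB (bracketC z y) (bracketC z x) opprK addrC. Qed.

Lemma bracketxN x y : bracket x (- y) = - bracket x y.
Proof. by rewrite -[- y]sub0r bracketBr bracketx0 sub0r. Qed.

Lemma bracket_leibniz x y z :
  bracket x (bracket y z) = bracket (bracket x y) z + bracket y (bracket x z).
Proof.
apply/eqP; rewrite -subr_eq0 opprD addrA addrAC; apply/eqP.
by rewrite -[RHS](bracket_jacobi x y z) (bracketC z x) bracketxN (bracketC z (bracket x y)).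
Qed.

Lemma iter_bracketB x k : {morph iter k (bracket x) : y z / y - z}.
Proof. by elim: k => // k IH y z; rewrite !iterS IH bracketBr. Qed.

Lemma iter_bracketD x k : {morph iter k (bracket x) : y z / y + z}.
Proof. by elim: k => // k IH y z; rewrite !iterS IH bracketDr. Qed.

Lemma iter_bracket0 x k : iter k (bracket x) 0 = 0.
Proof. by elim: k => // k IH; rewrite iterS IH bracketx0. Qed.

(** When [C 0] is [N], the case [j = 0] says that ad(h') maps ker ad(h)^k into ker ad(h)^(k+n). By
    the Leibniz rule, [h,[h',v]] is the sum of [[h,h'],v], where [h,h'] lies one step further along
    the series, and [h',[h,v]], where [h,v] is killed by one power fewer; hence the double
    induction. *)
Lemma iter_bracket_nilpotent (N : set g) (n : nat) (C : nat -> set g) (h : g) :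
  C n = [set 0] ->
  (forall j, (j < n)%N -> forall x y, N x -> C j y -> C j.+1 (bracket x y)) ->
  N h ->
  forall m j, (j + m)%N = n -> forall k h' v, C j h' ->
    iter k (bracket h) v = 0 -> iter (k + m) (bracket h) (bracket h' v) = 0.
Proof.
move=> Cn Cstep Nh; elim=> [|m IHm] j.
  rewrite addn0 => -> k h' v; rewrite Cn => -> _.
  by rewrite bracket0x iter_bracket0.
move=> jm; elim=> [|k IHk] h' v.
  by move=> _ v0; rewrite (v0 : v = 0) bracketx0 iter_bracket0.
move=> Ch' hv; rewrite addSn iterSr bracket_leibniz.
rewrite iter_bracketD (IHk h' (bracket h v)) -?iterSr // addr0 addnS -addSn.
apply: (IHm j.+1) => //; first by rewrite addSnnS.
by apply: Cstep => //; rewrite -jm -addSnnS leq_addr.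
Qed.

End Brackets.

(** If it fails, some sequence [x] in [W] is pairwise incongruent modulo the good elements. By the
    index bound, every [h] in [N] sends some difference [x l - x j] with [j < l <= d] into [c]. So
    finitely many subgroups cover [N], one of them has finite index by Neumann's lemma, and the
    corresponding difference is good, a contradiction. *)
Lemma bilinear_symmetry (g : lieRingType) (c N W : set g) (d : nat) :
  subgroup c -> subgroup N -> subgroup W ->
  (forall h, N h -> index_le d (bracket h @^-1` c) W) ->
  acont W [set w | W w /\ acont N [set h | c (bracket h w)]].
Proof.
move=> Hc HN HW idx; apply: contrapT => /not_acont_seq[x [Wx nx]].
pose r := [seq jl <- [seq (j, l) | j <- iota 0 d.+1, l <- iota 0 d.+1] | (jl.1 < jl.2)%N].
case: (@neumann_covering g (nat * nat)%type (fun jl => [set h | c (bracket h (x jl.2 - x jl.1))]) r [:: 0] N HN).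
- move=> jl; split; first by rewrite /= bracket0x; case: Hc.
  by move=> y z cy cz; rewrite /= bracketBl; apply: subgroupB.
- move=> h Nh; have [j [l [jl ld cjl]]] := idx h Nh x Wx.
  exists (j, l); last by exists 0; rewrite ?inE // subr0.
  rewrite mem_filter jl; apply: (allpairs_f pair); rewrite mem_iota //=.
  by rewrite ltnS (leq_trans (ltnW jl)).
move=> [j l]; rewrite mem_filter => /andP[/= jl _] Nc.
by apply: (nx j l jl); split=> //; apply: subgroupB.
Qed.


(* D is the class of definable subgroups; rk will be the dimension. *)
Section FrattiniArgument.
Variables (g : lieRingType) (i c N : set g) (D : set g -> Prop) (rk : set g -> nat).
Hypothesis D_subgroup : forall H, D H -> subgroup H.
Hypothesis D_setT : D setT.
Hypothesis D_0 : D [set 0].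
Hypothesis D_i : D i.
Hypothesis D_c : D c.
Hypothesis D_I : forall H K, D H -> D K -> D (H `&` K).
Hypothesis D_sum : forall H K, D H -> D K -> D (sumset H K).
Hypothesis D_bracket : forall x H, D H -> D (bracket x @` H).
Hypothesis D_preim : forall x H, D H -> D (bracket x @^-1` H).
Hypothesis rk_acont : forall H K, D H -> D K -> acont H K -> (rk H <= rk K)%N.
Hypothesis acont_rk : forall H K, D H -> D K -> acont H K -> (rk K <= rk H)%N ->
  acont K H.
Hypothesis uniform_index : forall W, D W ->
  (forall h, N h -> acont W (bracket h @^-1` c)) ->
  exists W' d, [/\ subgroup W', W' `<=` W, acont W W' &
    forall h, N h -> index_le d (bracket h @^-1` c) W'].
Hypothesis i_ideal : ideal_of setT i.
Hypothesis c_subring : lie_subring c.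
Hypothesis c_sub_i : c `<=` i.
Hypothesis N_sub_c : N `<=` c.
Hypothesis N_subgroup : subgroup N.
Hypothesis c_acont_N : acont c N.
Hypothesis N_nilpotent : nilpotent N.
Hypothesis norm_acont_c : acont (almost_normaliser i c) c.

Lemma D_iter x k H : D H -> D (iter k (bracket x) @` H).
Proof.
move=> DH; elim: k => [|k IH]; first by rewrite image_id.
by rewrite -[iter _ _]/(bracket x \o iter k (bracket x)) -image_comp; apply: D_bracket.
Qed.

Lemma D_ker x k : D [set v | iter k (bracket x) v = 0].
Proof.
elim: k => [|k IH]; first exact: D_0.
rewrite (_ : mkset _ = bracket x @^-1` [set v | iter k (bracket x) v = 0]); first exact: D_preim.
by apply/seteqP; split=> v; rewrite /preimage /= -iterSr.
Qed.

Let c_subgroup : subgroup c. Proof. exact: D_subgroup. Qed.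
Let i_subgroup : subgroup i. Proof. exact: D_subgroup. Qed.

Let N_i h : N h -> i h. Proof. by move=> /N_sub_c /c_sub_i. Qed.

Let ad_i h x : N h -> i (bracket h x).
Proof.
move=> /N_i ih; rewrite bracketC; apply: subgroupN => //.
by case: i_ideal => _ _; apply.
Qed.

Let ad_c h x : N h -> c x -> c (bracket h x).
Proof. by move=> /N_sub_c ch cx; case: c_subring => _; apply. Qed.

Let bracket_sub x : {morph bracket x : y z / y - z} := @bracketBr g x.

(** Exchanges the quantifiers: [bilinear_symmetry] applies on a finite-index part of [W] where the
    indices are uniformly bounded, and then [N] is traded for [c], which is almost contained in
    it. *)
Lemma acont_almost_normaliser (A W : set g) : D W -> W `<=` A ->
  (forall h, N h -> acont (bracket h @` W) c) ->
  acont W (almost_normaliser A c).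
Proof.
move=> DW WA Wc.
have [|W' [d [HW' W'W WW' W'idx]]] := uniform_index DW.
  by move=> h Nh; apply: acont_preimage => //; apply: Wc.
apply: (acont_trans WW'); apply: acont_trans (bilinear_symmetry c_subgroup N_subgroup HW' W'idx) _.
apply: acont_sub => w [/W'W/WA Aw Nw]; split=> //.
apply/almost_containedP => //; first exact: subgroup_image.
apply: acont_trans (acont_image (@bracketBr g w) (acont_trans c_acont_N Nw)) _.
by apply: acont_sub => _ [h /= chw <-]; rewrite bracketC; apply: subgroupN.
Qed.

(** An Engel theorem up to finite index. In a counterexample of minimal rank, ad(h) sends [W] almost
    into [c] for all [h] in [N], by descent along the central series; then [W] almost normalises
    [c], so it is almost contained in [c] after all. *)
Lemma engel_almost (W : set g) :
  D W -> c `<=` W -> W `<=` i ->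
  (forall h, N h -> acont (bracket h @` W) W) ->
  (forall h, N h -> exists k, acont (iter k (bracket h) @` W) c) ->
  acont W c.
Proof.
move=> DW0 cW0 W0i W0inv W0nil; apply: contrapT => W0c.
pose Q W := [/\ [/\ D W, c `<=` W & W `<=` i],
  forall h, N h -> acont (bracket h @` W) W,
  forall h, N h -> exists k, acont (iter k (bracket h) @` W) c & ~ acont W c].
have [|{W DW0 cW0 W0i W0inv W0nil W0c}W [[[DW cW Wi] Winv Wnil Wc] Wmin]] := @exists_min_nat _ Q rk.
  by exists W.
have HW := D_subgroup DW.
have [n [C [C0 Cn Cideal Cstep]]] := N_nilpotent.
have CN j h : (j <= n)%N -> C j h -> N h by move=> /Cideal[CN _ _] /CN.
(* Induction from the zero end of the series up to [C 0], which is [N]; [m] counts the steps that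
   separate [C j] from zero. *)
suff main m j : (j + m)%N = n -> forall h, C j h -> acont (bracket h @` W) c.
  apply: Wc; apply: acont_trans norm_acont_c; apply: acont_almost_normaliser => // h.
  by rewrite -C0; apply: (main n); rewrite add0n.
elim: m j => [|m IH] j jn h Cjh.
  move: Cjh; rewrite -{1}[j]addn0 jn Cn => ->; apply: acont_sub => _ [w _ <-].
  by rewrite bracket0x; apply: subgroup0.
have Nh : N h by apply: CN Cjh; rewrite -jn leq_addr.
pose W' := sumset (bracket h @` W) c.
have HhW : subgroup (bracket h @` W) by apply: subgroup_image.
have HW' : subgroup W' by apply: subgroup_sum.
have W'W : acont W' W by apply: acont_sum => //; [exact: Winv|exact: acont_sub].
have cW' : c `<=` W' by apply: subset_sumr.
have [W'c|W'c] := pselect (acont W' c).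
  by apply: acont_trans W'c; apply/acont_sub/subset_suml.
(* As [W'] is not almost contained in [c], it is again a counterexample, so minimality of [W] forces
   equal rank. *)
have WW' : acont W W'.
  have DW' : D W' by apply: D_sum => //; apply: D_bracket.
  apply: acont_rk => //; apply: Wmin; split=> //.
  - split=> // _ [_ [w Ww <-] [x cx <-]]; apply: subgroupD => //; [exact: ad_i|exact: c_sub_i].
  (* Almost invariance of [W']: [h',[h,w]] = [h,[h',w]] + [[h',h],w], and the last term is
     controlled by the induction hypothesis because [h',h] lies in [C j.+1]. *)
  - move=> h' Nh'; have Chh' : C j.+1 (bracket h' h).
      by apply: (proj2 (Cstep j _)); rewrite // -jn -addSnnS leq_addr.
    apply: (@acont_trans _ _ (sumset (bracket h @` (bracket h' @` W)) (sumset (bracket (bracket h' h) @` W) c))).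
      apply: acont_sub => _ [_ [_ [w Ww <-] [x cx <-]] <-].
      exists (bracket h (bracket h' w)); first by exists (bracket h' w) => //; exists w.
      exists (bracket (bracket h' h) w + bracket h' x).
        exists (bracket (bracket h' h) w); first by exists w.
        by exists (bracket h' x) => //; apply: ad_c.
      by rewrite bracketDr addrA (bracket_leibniz h') [in RHS](addrC (bracket _ w)).
    apply: acont_sum => //; last first.
      apply: acont_sum => //; last exact: acont_sub.
      by apply: (acont_trans (IH j.+1 _ _ Chh')); rewrite ?addSnnS //; apply: acont_sub.
    apply: acont_trans (acont_image (@bracketBr g h) (Winv h' Nh')) _.
    by apply/acont_sub/subset_suml.
  - move=> h' Nh'; have [k kP] := Wnil h' Nh'; exists k.
    apply: acont_trans kP; apply: acont_image W'W; exact: iter_bracketB.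
(* Iterating [WW'] puts [W] almost inside ad(h)^l W + c for every [l]; for [l = k] almost nilpotence
   brings this down to [c]. *)
case: Wc; have [k kP] := Wnil h Nh.
suff iterW l : acont W (sumset (iter l (bracket h) @` W) c).
  by apply: acont_trans (iterW k) _; apply: acont_sum => //; apply: acont_sub.
elim: l => [|l IHl]; first by apply: acont_sub; rewrite image_id; apply: subset_suml.
apply: acont_trans WW' _; apply: acont_sum.
- by apply: subgroup_sum => //; apply: subgroup_image => //; apply: iter_bracketB.
- apply: acont_trans (acont_image (@bracketBr g h) IHl) _; apply: acont_sub.
  move=> _ [_ [_ [w Ww <-] [x cx <-]] <-].
  exists (iter l.+1 (bracket h) w); first by exists w.
  by exists (bracket h x); [exact: ad_c|rewrite bracketDr].
by apply/acont_sub/subset_sumr; apply: subgroup_image => //; apply: iter_bracketB.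
Qed.

(** With f = ad(h)^k, stability of the rank makes f(E) almost contained in f(f(E)). So almost every
    [e] satisfies f(e) = f(f(e')), and e = f(e') + (e - f(e')) has its first term in [i], since [k]
    is positive, and its second in ker f. *)
Lemma fitting_almost (E : set g) (h : g) (k : nat) : N h -> D E -> (0 < k)%N ->
  (forall l, acont (iter l (bracket h) @` E) E) ->
  (rk (iter k (bracket h) @` E) <= rk (iter (k + k) (bracket h) @` E))%N ->
  acont E (sumset i (E `&` [set v | iter k (bracket h) v = 0])).
Proof.
move=> Nh DE k0 Einv Erk; set f := iter k (bracket h).
have fB : {morph f : y z / y - z} by apply: iter_bracketB.
have HE := D_subgroup DE.
have HfE : subgroup (f @` E) by apply: subgroup_image.
have DfE : D (f @` E) by apply: D_iter.
have ffE : acont (f @` (f @` E)) (f @` E) by apply: acont_image => //; apply: Einv.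
have fEff : acont (f @` E) (f @` (f @` E)).
  apply: acont_rk => //; first exact: D_iter.
  by rewrite image_comp (_ : f \o f = iter (k + k) (bracket h)) //; apply/funext => v; rewrite /= iterD.
(* Taking [e'] in [E'] keeps f(e') in [E], hence also the kernel component e - f(e'). *)
pose E' := E `&` f @^-1` E.
have EE' : acont E E'.
  by apply: acontI => //; [exact: subgroup_preimage|exact: acont_sub|apply: acont_preimage => //; apply: Einv].
have HE' : subgroup E' by apply: subgroupI => //; apply: subgroup_preimage.
have HffE' : subgroup (f @` (f @` E')) by do 2!apply: subgroup_image => //.
have : acont E (f @^-1` (f @` (f @` E'))).
  apply: acont_preimage => //; apply: acont_trans fEff _.
  by do 2!apply: acont_image => //.
move=> /(acont_self HE (subgroup_preimage fB HffE')); move=> /acont_trans; apply.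
apply: acont_sub => e [Ee [_ [e' [Ee' Efe'] <-] ffe']].
exists (f e').
  by rewrite /f; case: (k) k0 => // m _; rewrite iterS; apply: ad_i.
exists (e - f e'); last by rewrite subrKC.
by split; [exact: subgroupB|rewrite /= -/f fB ffe' subrr].
Qed.

Theorem frattini_argument :
  acont setT (sumset i (almost_normaliser setT c)).
Proof.
pose Q E := [/\ D E, acont setT (sumset i E) & forall h, N h -> acont (bracket h @` E) E].
have [|E [[DE iE Einv] Emin]] := @exists_min_nat _ Q rk.
  exists setT; split=> //; last by move=> h _; apply: acont_sub.
  by apply/acont_sub/subset_sumr.
have HE := D_subgroup DE.
have Eiter h l : N h -> acont (iter l (bracket h) @` E) E.
  move=> Nh; elim: l => [|l IH]; first by rewrite image_id; apply: acont_sub.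
  rewrite -[iter _ _]/(bracket h \o iter l (bracket h)) -image_comp.
  by apply: acont_trans (Einv h Nh); apply: acont_image.
have Eker h : N h -> exists k, acont E [set v | iter k (bracket h) v = 0].
  move=> Nh; have [n [C [C0 Cn Cideal Cstep]]] := N_nilpotent.
  pose K k := E `&` [set v | iter k (bracket h) v = 0].
  have DK k : D (K k) by apply: D_I => //; apply: D_ker.
  have Ksub k : K k `<=` K k.+1 by move=> v [Ev hv]; split=> //; rewrite /mkset iterS hv bracketx0.
  have KE k : (rk (K k) <= rk E)%N by apply: rk_acont => //; apply: acont_sub => v [].
  have [k1 k1P] : exists k0, forall k, (k0 <= k)%N -> rk (iter k (bracket h) @` E) = rk (iter k0 (bracket h) @` E).
    apply: (@nonincreasing_stable (fun k => rk (iter k (bracket h) @` E))) => k.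
    apply: rk_acont; try exact: D_iter.
    rewrite (_ : iter k.+1 (bracket h) = iter k (bracket h) \o bracket h); last by apply/funext => v; rewrite iterSr.
    rewrite -image_comp; apply: acont_image; [exact: iter_bracketB|exact: Einv].
  (* The ranks of the increasing kernels are bounded by [rk E]; subtracting from it gives a
     nonincreasing sequence. *)
  have [k2 k2P] : exists k0, forall k, (k0 <= k)%N -> (rk E - rk (K k))%N = (rk E - rk (K k0))%N.
    apply: (@nonincreasing_stable (fun k => rk E - rk (K k))%N) => k.
    by apply/leq_sub2l/rk_acont => //; apply: acont_sub.
  have k2rk k : (k2 <= k)%N -> rk (K k) = rk (K k2).
    by move=> /k2P; rewrite -{2}(subKn (KE k)) -{2}(subKn (KE k2)) => ->.
  (* Images and kernels are both stable from here on; the successor provides the positivity required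
     by [fitting_almost]. *)
  pose k := (k1 + k2).+1; exists k.
  have k1k : (k1 <= k)%N by rewrite /k -addnS leq_addr.
  have k2k : (k2 <= k)%N by rewrite /k -addSn leq_addl.
  apply: (@acont_trans _ _ (K k)); last by apply: acont_sub => v [].
  apply: acont_rk => //; first by apply: acont_sub => v [].
  (* [K k] satisfies the conditions under which [E] is minimal, so it has the rank of [E] and hence
     finite index in it. *)
  apply: Emin; split=> //.
    apply: acont_trans iE _; apply: acont_sum; first by apply: subgroup_sum => //; apply: D_subgroup.
      by apply/acont_sub/subset_suml/D_subgroup.
    apply: fitting_almost => //; first by move=> l; apply: Eiter.
    by rewrite (k1P k) // (k1P (k + k)%N) // (leq_trans k1k) // leq_addr.
  (* ad(h') maps [K k] almost into [K (k + n)], which is almost contained in [K k] because the ranks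
     are stable. *)
  move=> h' Nh'; apply: (@acont_trans _ _ (K (k + n)%N)); last first.
    apply: acont_rk => //.
      apply: acont_sub => v [Ev hv]; split=> //.
      by rewrite /mkset addnC iterD hv iter_bracket0.
    by rewrite (k2rk (k + n)%N) ?(k2rk k) // (leq_trans k2k) // leq_addr.
  apply: acontI => //; first exact: D_subgroup (D_ker _ _).
    apply: acont_trans (Einv h' Nh'); apply: acont_sub.
    by apply: image_subset => v [].
  apply: acont_sub => _ [v [_ hv] <-] /=.
  apply: (iter_bracket_nilpotent Cn _ Nh (j := 0)) hv => //; last by rewrite C0.
  by move=> j jn; case: (Cstep j jn).
(* Adding [c] meets the requirement of [engel_almost] that [c] be contained in the subgroup. *)
pose V := sumset (E `&` i) c.
have EiV : E `&` i `<=` V by apply: subset_suml.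
have cV : c `<=` V by apply/subset_sumr/subgroupI.
have EEi h : N h -> acont (bracket h @` E) (E `&` i).
  move=> Nh; apply: acontI => //; first exact: Einv.
  by apply: acont_sub => _ [v _ <-]; apply: ad_i.
have DV : D V by apply: D_sum => //; apply: D_I.
have Vc : acont V c.
  apply: engel_almost => //.
  - move=> _ [x [_ ix] [y cy <-]]; apply: subgroupD => //; exact: c_sub_i.
  - move=> h Nh; apply: (@acont_trans _ _ (sumset (bracket h @` E) c)).
      apply: acont_sub => _ [_ [x [Ex _] [y cy <-]] <-]; rewrite bracketDr.
      exists (bracket h x); first by exists x.
      by exists (bracket h y) => //; apply: ad_c.
    apply: acont_sum; [exact: D_subgroup| |exact: acont_sub].
    by apply: acont_trans (EEi h Nh) _; apply: acont_sub.
  move=> h Nh; have [k kP] := Eker h Nh; exists k.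
  apply: (@acont_trans _ _ (sumset (iter k (bracket h) @` E) c)).
    apply: acont_sub => _ [_ [x [Ex _] [y cy <-]] <-]; rewrite iter_bracketD.
    exists (iter k (bracket h) x); first by exists x.
    exists (iter k (bracket h) y) => //; elim: (k) => // m IH.
    by rewrite iterS; apply: ad_c.
  apply: acont_sum => //; last exact: acont_sub.
  apply: acont_trans (acont_image (@iter_bracketB g h k) kP) _.
  by apply: acont_sub => _ [v /= -> <-]; apply: subgroup0.
apply: acont_trans iE _; apply: acont_sumS.
apply: acont_almost_normaliser => // h Nh.
apply: acont_trans (EEi h Nh) _; apply: acont_trans Vc; exact: acont_sub.
Qed.

End FrattiniArgument.

(** * Definability with parameters *)

Fixpoint ren_term (L : language) n m (s : 'I_n -> 'I_m) (t : term L n) : term L m :=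
  match t with
  | TVar i => TVar L (s i)
  | TFun f args => TFun (fun i => ren_term s (args i))
  end.

Definition lift_ren n m (s : 'I_n -> 'I_m) (i : 'I_n.+1) : 'I_m.+1 :=
  if unlift ord0 i is Some j then lift ord0 (s j) else ord0.

Fixpoint ren_formula (L : language) n (phi : formula L n) :
    forall m, ('I_n -> 'I_m) -> formula L m :=
  match phi in formula _ n return forall m, ('I_n -> 'I_m) -> formula L m with
  | FFalse _ => fun m _ => FFalse L m
  | FEq _ t u => fun m s => FEq (ren_term s t) (ren_term s u)
  | FRel _ r args => fun m s => FRel (fun i => ren_term s (args i))
  | FImp _ phi psi => fun m s => FImp (ren_formula phi s) (ren_formula psi s)
  | FAll _ phi => fun m s => FAll (ren_formula phi (lift_ren s))
  end.

Section Renaming.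
Variables (L : language) (M : structure L).

Lemma eval_ren n m (s : 'I_n -> 'I_m) (t : term L n) (e : m.-tuple M) :
  eval e (ren_term s t) = eval [tuple tnth e (s i) | i < n] t.
Proof.
elim: t => [i|f args IH] /=; first by rewrite tnth_mktuple.
by congr (fun_interp _); apply: eq_from_tnth => i; rewrite !tnth_mktuple.
Qed.

Lemma sat_ren n (phi : formula L n) m (s : 'I_n -> 'I_m) (e : m.-tuple M) :
  sat (ren_formula phi s) e <-> sat phi [tuple tnth e (s i) | i < n].
Proof.
elim: phi m s e => {n} [n|n t u|n r args|n phi IHphi psi IHpsi|n phi IH] m s e //=.
- by rewrite !eval_ren.
- suff -> : [tuple eval e (ren_term s (args i)) | i < rel_arity r] =
    [tuple eval [tuple tnth e (s i) | i < n] (args i) | i < rel_arity r] by [].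
  by apply: eq_from_tnth => i; rewrite !tnth_mktuple eval_ren.
- by rewrite IHphi IHpsi.
suff E a : [tuple tnth [tuple of a :: e] (lift_ren s i) | i < n.+1] =
    [tuple of a :: [tuple tnth e (s i) | i < n]].
  by split=> H a; have := H a; rewrite IH E.
apply: eq_from_tnth => i; rewrite tnth_mktuple /lift_ren.
by case: unliftP => [j|] ->; rewrite ?tnth0 // !tnthS tnth_mktuple.
Qed.

End Renaming.

Definition assign (V A : Type) (e : V -> A) (v : V + A) : A :=
  match v with inl x => e x | inr a => a end.

(* Definability with parameters, for predicates of valuations [V -> M]: each
   variable of the formula is fed a variable in V or a parameter in M. *)
Definition def_pred (L : language) (M : structure L) (V : Type)
    (P : (V -> M) -> Prop) : Prop :=
  exists m (phi : formula L m) (v : 'I_m -> V + M),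
    forall e, P e <-> sat phi [tuple assign e (v i) | i < m].

(** * Closure of definable predicates under logical operations *)

Section DefPred.
Variables (L : language) (M : structure L).
Implicit Types V W : Type.

Lemma def_ext V (P Q : (V -> M) -> Prop) :
  (forall e, P e <-> Q e) -> def_pred P -> def_pred Q.
Proof. by move=> PQ [m [phi [v H]]]; exists m, phi, v => e; rewrite -PQ. Qed.

Lemma def_subst V W (s : V -> W + M) (P : (V -> M) -> Prop) :
  def_pred P -> def_pred (fun e => P (fun x => assign e (s x))).
Proof.
move=> [m [phi [v H]]].
exists m, phi, (fun i => match v i with inl x => s x | inr a => inr a end) => e.
rewrite H.
suff -> : [tuple assign (fun x => assign e (s x)) (v i) | i < m] =
  [tuple assign e (match v i with inl x => s x | inr a => inr a end) | i < m] by [].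
by apply: eq_from_tnth => i; rewrite !tnth_mktuple; case: (v i).
Qed.

Lemma def_ren V W (s : V -> W) (P : (V -> M) -> Prop) :
  def_pred P -> def_pred (fun e => P (fun x => e (s x))).
Proof. exact: (@def_subst _ _ (fun x => inl (s x))). Qed.

Lemma def_False V : def_pred (fun _ : V -> M => False).
Proof. by have v : 'I_0 -> V + M by [case]; exists 0%N, (FFalse L 0), v. Qed.

Lemma def_imp V (P Q : (V -> M) -> Prop) :
  def_pred P -> def_pred Q -> def_pred (fun e => P e -> Q e).
Proof.
move=> [m [phi [v H]]] [p [psi [w K]]].
exists (m + p)%N, (FImp (ren_formula phi (lshift p)) (ren_formula psi (@rshift m p))).
exists (fun i => match fintype.split i with inl j => v j | inr j => w j end) => e /=.
rewrite H K !sat_ren.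
set t := [tuple assign e (match fintype.split _ with inl j => v j | inr j => w j end) | _ < _].
suff [-> ->] : [tuple tnth t (lshift p i) | i < m] = [tuple assign e (v i) | i < m] /\
  [tuple tnth t (rshift m i) | i < p] = [tuple assign e (w i) | i < p] by [].
split; apply: eq_from_tnth => i; rewrite !tnth_mktuple.
  by rewrite -[lshift p i]/(unsplit (inl i)) unsplitK.
by rewrite -[rshift m i]/(unsplit (inr i)) unsplitK.
Qed.

Lemma def_not V (P : (V -> M) -> Prop) : def_pred P -> def_pred (fun e => ~ P e).
Proof. by move=> HP; apply: def_imp => //; apply: def_False. Qed.

Lemma def_and V (P Q : (V -> M) -> Prop) :
  def_pred P -> def_pred Q -> def_pred (fun e => P e /\ Q e).
Proof.
move=> HP HQ; apply: (@def_ext _ (fun e => ~ (P e -> ~ Q e))).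
  by move=> e; split=> [/not_implyP[? /contrapT]|[Pe Qe]]; [|apply].
by apply/def_not/def_imp => //; apply: def_not.
Qed.

Definition extend V A (e : V -> A) (a : A) (o : option V) : A :=
  if o is Some x then e x else a.

Lemma def_all V (P : (option V -> M) -> Prop) :
  def_pred P -> def_pred (fun e : V -> M => forall a, P (extend e a)).
Proof.
move=> [m [phi [v H]]]; have [pt] := carrier_inhabited M.
(* Slots fed by the quantified variable are redirected to the bound index 0; in the outer valuation
   [w] they receive the arbitrary value [pt]. *)
pose s (i : 'I_m) : 'I_m.+1 := if v i is inl None then ord0 else lift ord0 i.
pose w i := match v i with
  | inl (Some x) => inl x | inl None => inr pt | inr a => inr a end.
exists m, (FAll (ren_formula phi s)), w => e /=.
suff E a : [tuple tnth [tuple of a :: [tuple assign e (w i) | i < m]] (s i) | i < m] =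
    [tuple assign (extend e a) (v i) | i < m].
  by split=> K a; have := K a; rewrite H sat_ren E.
apply: eq_from_tnth => i; rewrite !tnth_mktuple /s /w.
by case E : (v i) => [[x|]|b]; rewrite ?tnth0 ?tnthS ?tnth_mktuple ?E.
Qed.

Lemma def_ex V (P : (option V -> M) -> Prop) :
  def_pred P -> def_pred (fun e : V -> M => exists a, P (extend e a)).
Proof.
move=> HP; apply: (@def_ext _ (fun e => ~ forall a, ~ P (extend e a))).
  by move=> e; split=> [/existsNP[a /contrapT]|[a Pa] /(_ a)]; [exists a|].
by apply: def_not; apply: (@def_all _ (fun e => ~ P e)); apply: def_not.
Qed.

Lemma def_eq V (x y : V) : def_pred (fun e : V -> M => e x = e y).
Proof.
exists 2%N, (FEq (TVar L (@ord0 1)) (TVar L (@ord_max 1))).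
by exists (fun i => inl (if i == ord0 then x else y)) => e /=; rewrite !tnth_mktuple.
Qed.

Lemma def_fin_all V n (P : 'I_n -> (V -> M) -> Prop) :
  (forall j, def_pred (P j)) -> def_pred (fun e => forall j, P j e).
Proof.
move=> HP; suff H (r : seq 'I_n) : def_pred (fun e => forall j, j \in r -> P j e).
  by apply: def_ext (H (enum 'I_n)) => e; split=> K j *; apply: K; rewrite mem_enum.
elim: r => [|j r IH].
  by apply: def_ext (def_imp (@def_False V) (@def_False V)).
apply: def_ext (def_and (HP j) IH) => e; split=> [[Pj Pr] k|K].
  by rewrite inE => /orP[/eqP->|/Pr].
by split=> [|k kr]; apply: K; rewrite inE ?eqxx ?kr ?orbT.
Qed.

Lemma def_ex_block V n (P : (V + 'I_n -> M) -> Prop) : def_pred P ->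
  def_pred (fun e => exists t : n.-tuple M,
    P (fun z => match z with inl x => e x | inr j => tnth t j end)).
Proof.
elim: n V P => [|n IH] V P HP.
  apply: (@def_ext _ (fun e => P (fun z => match z with inl x => e x | inr j => tnth [tuple] j end))).
    by move=> e; split=> [H|[t]]; [exists [tuple]|rewrite (tuple0 t)].
  have [pt] := carrier_inhabited M.
  apply: def_ext (def_subst (fun z => match z with inl x => inl x | inr _ => inr pt end) HP) => e.
  by rewrite (_ : (fun _ => _) = fun z => match z with inl x => e x | inr j => tnth [tuple] j end) //;
    apply/funext => -[x|[]].
pose s (z : V + 'I_n.+1) : option V + 'I_n := match z with
  | inl x => inl (Some x)
  | inr j => if unlift ord0 j is Some k then inr k else inl None end.
apply: def_ext (def_ex (IH _ _ (def_ren s HP))) => e.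
have E a (t : n.-tuple M) : (fun x => match s x with inl x => extend e a x | inr j => tnth t j end) =
    (fun z => match z with inl x => e x | inr j => tnth [tuple of a :: t] j end).
  apply/funext => -[x|j] //=; rewrite /s.
  by case: unliftP => [k|] ->; rewrite ?tnthS ?tnth0.
split=> [[a [t]]|[t]]; first by rewrite E; exists [tuple of a :: t].
by case/tupleP: t => a t; exists a, t; rewrite E.
Qed.

Lemma definable_def n (D : set (n.-tuple M)) :
  definable D -> def_pred (fun e => D [tuple e i | i < n]).
Proof.
move=> [m [phi [a ->]]].
exists (n + m)%N, phi, (fun i => match fintype.split i with inl j => inl j | inr j => inr (tnth a j) end) => e.
suff -> : [tuple assign e (match fintype.split i with inl j => inl j | inr j => inr (tnth a j) end) | i < n + m]
  = [tuple of [tuple e i | i < n] ++ a] by [].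
apply: eq_from_tnth => i; rewrite tnth_mktuple -[i in RHS]fintype.splitK.
by case: (fintype.split i) => j /=; rewrite ?tnth_lshift ?tnth_rshift ?tnth_mktuple.
Qed.

(** [interpretable] requires one parameter tuple for both formulas, so the two slot lists are
    concatenated; slots fed by a variable are redirected to that variable and hold the arbitrary
    [pt]. *)
Lemma def_common_params n (D : set (n.-tuple M)) (E : n.-tuple M -> n.-tuple M -> Prop) :
  def_pred (fun e => D [tuple e i | i < n]) ->
  def_pred (fun e => E [tuple e (inl i) | i < n] [tuple e (inr i) | i < n]) ->
  exists m (delta : formula L (n + m)) (eps : formula L (n + (n + m))) (a : m.-tuple M),
    sol_set delta a = D /\ sol_rel eps a = E.
Proof.
move=> [m [phi [v H]]] [p [psi [w K]]]; have [pt] := carrier_inhabited M.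
pose val V (z : V + M) := if z is inr a then a else pt.
pose a := [tuple match fintype.split k with inl i => val _ (v i) | inr i => val _ (w i) end | k < m + p].
exists (m + p)%N, (ren_formula phi (fun i => match v i with
  | inl j => lshift (m + p) j | inr _ => rshift n (lshift p i) end)).
exists (ren_formula psi (fun i => match w i with
  | inl (inl j) => lshift (n + (m + p)) j | inl (inr j) => rshift n (lshift (m + p) j)
  | inr _ => rshift n (rshift n (rshift m i)) end)), a.
have al i : tnth a (lshift p i) = val _ (v i).
  by rewrite tnth_mktuple -[lshift p i]/(unsplit (inl i)) unsplitK.
have ar i : tnth a (rshift m i) = val _ (w i).
  by rewrite tnth_mktuple -[rshift m i]/(unsplit (inr i)) unsplitK.
split.
  apply/funext => x; apply/propext; rewrite /sol_set /mkset sat_ren.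
  rewrite -[x in D x](_ : [tuple tnth x i | i < n] = x); last first.
    by apply: eq_from_tnth => i; rewrite tnth_mktuple.
  rewrite H; set t := mktuple _; set u := mktuple _; suff -> : t = u by [].
  apply: eq_from_tnth => i; rewrite !tnth_mktuple.
  by case E1 : (v i) => [j|b] /=; rewrite ?tnth_lshift ?tnth_rshift ?al ?E1.
apply/funext => x; apply/funext => y; apply/propext; rewrite /sol_rel sat_ren.
pose e (z : 'I_n + 'I_n) := match z with inl i => tnth x i | inr i => tnth y i end.
have -> : E x y = E [tuple e (inl i) | i < n] [tuple e (inr i) | i < n].
  by congr E; apply: eq_from_tnth => i; rewrite tnth_mktuple.
rewrite K; set t := mktuple _; set u := mktuple _; suff -> : t = u by [].
apply: eq_from_tnth => i; rewrite !tnth_mktuple.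
by case E1 : (w i) => [[j|j]|b] /=; rewrite ?tnth_lshift ?tnth_rshift ?tnth_lshift ?tnth_rshift ?ar ?E1.
Qed.

Lemma def_definable n (D : set (n.-tuple M)) :
  def_pred (fun e => D [tuple e i | i < n]) -> definable D.
Proof.
move=> HD; have [|m [delta [_ [a [<- _]]]]] := @def_common_params n D (fun _ _ => False) HD.
  exact: def_False.
by exists m, delta, a.
Qed.

Lemma interpretable_quotient n (D : set (n.-tuple M)) (E : n.-tuple M -> n.-tuple M -> Prop) :
  def_pred (fun e => D [tuple e i | i < n]) ->
  def_pred (fun e => E [tuple e (inl i) | i < n] [tuple e (inr i) | i < n]) ->
  equivalence_on D E -> interpretable (quotient_set D E).
Proof.
move=> HD HE eqE; have [m [delta [eps [a [Da Ea]]]]] := def_common_params HD HE.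
by exists m, delta, eps, a; rewrite Da Ea.
Qed.

End DefPred.

(** * Definable relations on a type with coordinates in the structure *)

Section GroupDefinability.
Variables (L : language) (M : structure L) (A : Type) (n : nat) (q : A -> n.-tuple M).
Hypothesis range_q : definable (range q).
Implicit Types V W : Type.

(* The elements of A stand for the n-tuples [q a].  In an ultrapower q is not
   injective: A is the type of all sequences, and its equality is the one
   pulled back along q. *)
Definition gdef V (R : (V -> A) -> Prop) : Prop :=
  exists P : (V * 'I_n -> M) -> Prop,
    def_pred P /\ forall e, R e <-> P (fun vj => tnth (q (e vj.1)) vj.2).

Definition gset (X : set A) : Prop := gdef (fun e : unit -> A => X (e tt)).

Lemma gdef_ext V (R S : (V -> A) -> Prop) :
  (forall e, R e <-> S e) -> gdef R -> gdef S.
Proof. by move=> RS [P [HP H]]; exists P; split=> // e; rewrite -RS. Qed.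

Lemma gdef_subst V W (s : V -> W + A) (R : (V -> A) -> Prop) :
  gdef R -> gdef (fun e => R (fun x => assign e (s x))).
Proof.
move=> [P [HP H]].
pose s' (vj : V * 'I_n) : W * 'I_n + M := match s vj.1 with
  | inl w => inl (w, vj.2) | inr a => inr (tnth (q a) vj.2) end.
exists (fun e => P (fun vj => assign e (s' vj))); split; first exact: def_subst.
move=> e; rewrite H; set f := fun _ => _; set f' := fun _ => _; suff -> : f = f' by [].
by apply/funext => -[v j]; rewrite /f /f' /s' /=; case: (s v).
Qed.

Lemma gdef_ren V W (s : V -> W) (R : (V -> A) -> Prop) :
  gdef R -> gdef (fun e => R (fun x => e (s x))).
Proof. exact: (@gdef_subst _ _ (fun x => inl (s x))). Qed.

Lemma gdef_gset V (x : V) X : gset X -> gdef (fun e => X (e x)).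
Proof. exact: (@gdef_ren _ _ (fun=> x)). Qed.

Lemma gdef_True V : gdef (fun _ : V -> A => True).
Proof.
exists (fun _ => False -> False); split=> //.
by apply: def_imp; exact: def_False.
Qed.

Lemma gdef_and V (R S : (V -> A) -> Prop) :
  gdef R -> gdef S -> gdef (fun e => R e /\ S e).
Proof.
move=> [P [HP H]] [Q [HQ K]]; exists (fun e => P e /\ Q e).
by split=> [|e]; [exact: def_and|rewrite H K].
Qed.

(** A quantifier over [A] becomes a block of [n] quantifiers over [M] restricted to the definable
    range of [q]. *)
Lemma gdef_ex V (R : (V -> A) -> A -> Prop) :
  gdef (fun e : option V -> A => R (fun x => e (Some x)) (e None)) ->
  gdef (fun e => exists a, R e a).
Proof.
move=> [P [HP H]].
pose s (vj : option V * 'I_n) : (V * 'I_n) + 'I_n := match vj.1 with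
  | Some v => inl (v, vj.2) | None => inr vj.2 end.
have := def_ex_block (def_and (def_ren (fun j => inr j) (definable_def range_q)) (def_ren s HP)).
move=> HQ; eexists; split; first exact: HQ.
move=> e; split=> [[a Ra]|[t [[a _ qa] Pt]]].
  have /H {}Ra : R (fun x => extend e a (Some x)) (extend e a None) by [].
  exists (q a); split; first by exists a => //; apply: eq_from_tnth => j; rewrite tnth_mktuple.
  move: Ra; set f := fun _ => _; set f' := fun _ => _; suff -> : f = f' by [].
  by apply/funext => -[[v|] j].
exists a; suff /H : P (fun vj => tnth (q (extend e a vj.1)) vj.2) by [].
move: Pt; set f := fun _ => _; set f' := fun _ => _; suff -> : f = f' by [].
by apply/funext => -[[v|] j] //=; rewrite /f /f' /= qa tnth_mktuple.
Qed.

Lemma gdef_saturated V (R : (V -> A) -> Prop) e e' :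
  gdef R -> (forall x, q (e x) = q (e' x)) -> R e -> R e'.
Proof.
move=> [P [_ H]] ee' /H Pe; apply/H; move: Pe.
by under eq_fun do rewrite ee'.
Qed.

Lemma gset_saturated X a b : gset X -> q a = q b -> X a -> X b.
Proof. by move=> HX ab; apply: (gdef_saturated (e := fun=> a) (e' := fun=> b) HX). Qed.

Lemma gset_of_definable X : (forall a b, q a = q b -> X a -> X b) ->
  definable (q @` X) -> gset X.
Proof.
move=> Xsat /definable_def HX.
exists (fun e => (q @` X) [tuple e (tt, i) | i < n]); split.
  exact: (def_ren (fun i => (tt, i)) HX).
move=> e; rewrite (_ : mktuple _ = q (e tt)); last first.
  by apply: eq_from_tnth => i; rewrite tnth_mktuple.
by split=> [|[a Xa /Xsat]]; [exists (e tt)|apply].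
Qed.

Lemma gset_def X : gset X -> def_pred (fun e : 'I_n -> M => (q @` X) [tuple e i | i < n]).
Proof.
move=> HX; have [P [HP H]] := HX.
apply: def_ext (def_and (definable_def range_q) (def_ren (fun vj : unit * 'I_n => vj.2) HP)) => e.
have E a : q a = [tuple e i | i < n] -> X a <-> P (fun vj => e vj.2).
  move=> qa; rewrite (H (fun=> a)) /= qa.
  by under eq_fun do rewrite tnth_mktuple.
split=> [[[a _ qa] Pe]|[a Xa qa]]; first by exists a => //; apply/(E _ qa).
by split; [exists a|apply/(E _ qa)].
Qed.

Definition tuple_rel (R : A -> A -> Prop) (t u : n.-tuple M) : Prop :=
  exists a b, [/\ t = q a, u = q b & R a b].

Lemma gdef_tuple_rel R : gdef (fun e : bool -> A => R (e true) (e false)) ->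
  def_pred (fun e : 'I_n + 'I_n -> M =>
    tuple_rel R [tuple e (inl i) | i < n] [tuple e (inr i) | i < n]).
Proof.
move=> [P [HP H]]; have Hr := definable_def range_q.
pose s (vj : bool * 'I_n) : 'I_n + 'I_n := if vj.1 then inl vj.2 else inr vj.2.
apply: def_ext (def_and (def_ren inl Hr) (def_and (def_ren inr Hr) (def_ren s HP))) => e.
have E a b : q a = [tuple e (inl i) | i < n] -> q b = [tuple e (inr i) | i < n] ->
    R a b <-> P (fun vj => e (s vj)).
  move=> qa qb; rewrite (H (fun z : bool => if z then a else b)).
  set f := fun _ => _; set f' := fun _ => _; suff -> : f = f' by [].
  by apply/funext => -[[] j]; rewrite /f /f' /s /= ?qa ?qb tnth_mktuple.
split=> [[[a _ qa] [[b _ qb] Pe]]|[a [b [qa qb Rab]]]].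
  by exists a, b; split=> //; apply/(E a b).
by split; [exists a|split; [exists b|apply/(E a b)]].
Qed.

Lemma gdef_definable_rel R : gdef (fun e : bool -> A => R (e true) (e false)) ->
  definable [set [tuple of xy.1 ++ xy.2] | xy in
    [set xy : n.-tuple M * n.-tuple M | tuple_rel R xy.1 xy.2]].
Proof.
move=> /gdef_tuple_rel HR; apply: def_definable.
pose s (z : 'I_n + 'I_n) := unsplit z.
apply: def_ext (def_ren s HR) => e.
have E : [tuple e i | i < n + n] =
    [tuple of [tuple e (s (inl i)) | i < n] ++ [tuple e (s (inr i)) | i < n]].
  apply: eq_from_tnth => i; rewrite tnth_mktuple -[i in LHS]fintype.splitK.
  rewrite -[i in RHS]fintype.splitK.
  by case: (fintype.split i) => j /=; rewrite ?tnth_lshift ?tnth_rshift ?tnth_mktuple.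
rewrite E; split=> [H|[[t u] /= H tu]].
  by exists ([tuple e (s (inl i)) | i < n], [tuple e (s (inr i)) | i < n]).
set t' := mktuple _; set u' := mktuple _.
have <- : t = t'.
  apply: eq_from_tnth => i; have := congr1 (fun w => tnth w (lshift n i)) tu.
  by rewrite !tnth_lshift.
have <- // : u = u'.
apply: eq_from_tnth => i; have := congr1 (fun w => tnth w (rshift n i)) tu.
by rewrite !tnth_rshift.
Qed.

Lemma gdef_graph V (f : A -> A -> A) (x y z : V) :
  (forall a a' b b', q a = q a' -> q b = q b' -> q (f a b) = q (f a' b')) ->
  definable [set [tuple of q xy.1 ++ [tuple of q xy.2 ++ q (f xy.1 xy.2)]] | xy in [set: A * A]] ->
  gdef (fun e : V -> A => q (f (e x) (e y)) = q (e z)).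
Proof.
move=> fq /definable_def Hf.
pose s (i : 'I_(n + (n + n))) : V * 'I_n := match fintype.split i with
  | inl j => (x, j)
  | inr k => match fintype.split k with inl j => (y, j) | inr j => (z, j) end end.
eexists; split; first exact: (def_ren s Hf).
move=> e; cbv beta; set t := mktuple _.
have tE : t = [tuple of q (e x) ++ [tuple of q (e y) ++ q (e z)]].
  apply: eq_from_tnth => i; rewrite tnth_mktuple /s -[i in RHS]fintype.splitK.
  case: (fintype.split i) => j /=; first by rewrite tnth_lshift.
  rewrite tnth_rshift -[j in RHS]fintype.splitK.
  by case: (fintype.split j) => k /=; rewrite ?tnth_lshift ?tnth_rshift.
rewrite tE; split=> [fE|[[a b] _ /= E]]; first by exists (e x, e y); rewrite //= fE.
have Ea : q a = q (e x).
  apply: eq_from_tnth => i; have := congr1 (fun w => tnth w (lshift _ i)) E.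
  by rewrite !tnth_lshift.
have Eb : q b = q (e y).
  apply: eq_from_tnth => i; have := congr1 (fun w => tnth w (rshift _ (lshift _ i))) E.
  by rewrite !tnth_rshift !tnth_lshift.
have <- : q (f a b) = q (e z).
  apply: eq_from_tnth => i; have := congr1 (fun w => tnth w (rshift _ (rshift _ i))) E.
  by rewrite !tnth_rshift.
by apply: fq.
Qed.

End GroupDefinability.

(** * Ultrapowers *)

Section Ultrapower.
Variables (L : language) (M : structure L) (U : set_system nat).
Context {UF : UltraFilter U}.
Implicit Types f h : nat -> M.

Lemma ultraS (P Q : set nat) : P `<=` Q -> U P -> U Q.
Proof. exact: filterS. Qed.

Lemma ultraI (P Q : set nat) : U P -> U Q -> U (P `&` Q).
Proof. exact: filterI. Qed.

Lemma ultraE (P : set nat) : (forall k, P k) -> U P.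
Proof. exact: filterE. Qed.

Lemma ultra_ex (P : set nat) : U P -> exists k, P k.
Proof. exact: filter_ex. Qed.

Lemma ultraN (P : set nat) : ~ U P <-> U (~` P).
Proof.
split=> [nP|UnP UP]; first by have [] := in_ultra_setVsetC P UF.
by have [k []] := ultra_ex (ultraI UP UnP).
Qed.

Definition germ f : set (nat -> M) := [set h | U [set k | f k = h k]].

(** Germs as classes of sequences, because [FEq] is interpreted by equality in the carrier. *)
Definition ultra_carrier : Type := {S : set (nat -> M) | exists f, S = germ f}.

Definition to_ultra f : ultra_carrier := exist _ (germ f) (ex_intro _ f erefl).

Definition of_ultra (a : ultra_carrier) : nat -> M := projT1 (cid (projT2 a)).

Lemma to_ultraP f h : to_ultra f = to_ultra h <-> U [set k | f k = h k].
Proof.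
split=> [/(congr1 (@proj1_sig _ _)) /= E|fh].
  have : germ h h by rewrite /germ /=; apply: ultraE => k.
  by rewrite -E.
rewrite /to_ultra; apply: eq_exist; apply/seteqP; split=> x H; rewrite /germ /= in H *.
  by apply: ultraS (ultraI fh H) => k [/= <-].
by apply: ultraS (ultraI fh H) => k [/= ->].
Qed.

Lemma of_ultraK a : to_ultra (of_ultra a) = a.
Proof.
case: a => S H; rewrite /to_ultra; apply: eq_exist.
by rewrite /of_ultra; case: cid => f /= <-.
Qed.

Lemma ultra_carrier_inhabited : inhabited ultra_carrier.
Proof. by have [pt] := carrier_inhabited M; exists; exact: to_ultra (fun=> pt). Qed.

Definition ultrapower : structure L := Structure ultra_carrier_inhabited
  (fun F args => to_ultra (fun k =>
     fun_interp [tuple of_ultra (tnth args i) k | i < fun_arity F]))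
  (fun R args => U [set k |
     rel_interp [tuple of_ultra (tnth args i) k | i < rel_arity R]]).

Lemma ultra_fin_all n (P : 'I_n -> set nat) :
  (forall i, U (P i)) -> U [set k | forall i, P i k].
Proof.
move=> HP; suff H (r : seq 'I_n) : U [set k | forall i, i \in r -> P i k].
  by apply: ultraS (H (enum 'I_n)) => k K i; apply: K; rewrite mem_enum.
elim: r => [|j r IH]; first by apply: ultraE => k.
apply: ultraS (ultraI (HP j) IH) => k [Pj Pr] i.
by rewrite inE => /orP[/eqP->|/Pr].
Qed.

(** The symbols of the ultrapower are interpreted through chosen representatives; these agree with
    the given sequences in almost every factor, at all coordinates at once. *)
Lemma of_to_ultra n (fs : 'I_n -> nat -> M) :
  U [set k | [tuple of_ultra (tnth [tuple to_ultra (fs i) | i < n] i) k | i < n] =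
             [tuple fs i k | i < n]].
Proof.
have : U [set k | forall i, of_ultra (to_ultra (fs i)) k = fs i k].
  apply: (@ultra_fin_all _ (fun i => [set k | of_ultra (to_ultra (fs i)) k = fs i k])) => i.
  by apply/to_ultraP; rewrite of_ultraK.
by apply: ultraS => k H; apply: eq_from_tnth => i; rewrite !tnth_mktuple H.
Qed.

Lemma eval_ultra n (t : term L n) (fs : 'I_n -> nat -> M) :
  eval (M := ultrapower) [tuple to_ultra (fs i) | i < n] t =
  to_ultra (fun k => eval [tuple fs i k | i < n] t).
Proof.
elim: t => [i|F args IH] /=.
  by rewrite tnth_mktuple; congr to_ultra; apply/funext => k; rewrite tnth_mktuple.
apply/to_ultraP.
have -> : [tuple eval (M := ultrapower) [tuple to_ultra (fs i) | i < n] (args j) | j < fun_arity F] =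
  [tuple to_ultra (fun k => eval [tuple fs i k | i < n] (args j)) | j < fun_arity F].
  by apply: eq_from_tnth => j; rewrite !tnth_mktuple IH.
by apply: ultraS (of_to_ultra (fun j k => eval [tuple fs i k | i < n] (args j))) => k /= ->.
Qed.

(** Los's theorem, by induction on the formula. *)
Lemma los n (phi : formula L n) (fs : 'I_n -> nat -> M) :
  sat (M := ultrapower) phi [tuple to_ultra (fs i) | i < n] <->
  U [set k | sat phi [tuple fs i k | i < n]].
Proof.
elim: phi fs => {n} [n|n t u|n r args|n phi IHphi psi IHpsi|n phi IH] fs /=.
- by split=> // /ultra_ex[].
- rewrite !eval_ultra; exact: to_ultraP.
- have -> : [tuple eval (M := ultrapower) [tuple to_ultra (fs i) | i < n] (args j) | j < rel_arity r] =
    [tuple to_ultra (fun k => eval [tuple fs i k | i < n] (args j)) | j < rel_arity r].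
    by apply: eq_from_tnth => j; rewrite !tnth_mktuple eval_ultra.
  have E := of_to_ultra (fun j k => eval [tuple fs i k | i < n] (args j)).
  by split=> H; apply: ultraS (ultraI E H) => k [/= ->].
- rewrite IHphi IHpsi; split=> H.
    have [UA|/ultraN UA] := pselect (U [set k | sat phi [tuple fs i k | i < n]]).
      by apply: ultraS (H UA) => k /= psik _.
    by apply: ultraS UA => k /= nk /nk.
  by move=> UA; apply: ultraS (ultraI H UA) => k [/= H1 /H1].
have E (f : nat -> M) : sat (M := ultrapower) phi [tuple of to_ultra f :: [tuple to_ultra (fs i) | i < n]] <->
    U [set k | sat phi [tuple of f k :: [tuple fs i k | i < n]]].
  pose gs (i : 'I_n.+1) := if unlift ord0 i is Some j then fs j else f.
  rewrite -[X in sat _ X <-> _](_ : [tuple to_ultra (gs i) | i < n.+1] = _); last first.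
    apply: eq_from_tnth => i; rewrite tnth_mktuple /gs.
    by case: unliftP => [j|] ->; rewrite ?tnth0 // tnthS tnth_mktuple.
  rewrite IH; set S := mkset _; set S' := mkset _; suff -> : S = S' by [].
  apply/seteqP; rewrite /S /S'; split=> k /=;
    rewrite (_ : [tuple gs i k | i < n.+1] = [tuple of f k :: [tuple fs i k | i < n]]) //;
    apply: eq_from_tnth => i; rewrite tnth_mktuple /gs;
    by case: unliftP => [j|] ->; rewrite ?tnth0 // tnthS tnth_mktuple.
split=> [H|H a]; last first.
  by rewrite -[a]of_ultraK; apply/E; apply: ultraS H => k; apply.
apply: contrapT => /ultraN nU.
have [pt] := carrier_inhabited M.
(* If the universal formula fails in almost every factor, the counterexamples form one sequence,
   whose germ is a counterexample in the ultrapower. *)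
have /choice[f fP] : forall k, exists a, ~ (forall a, sat phi [tuple of a :: [tuple fs i k | i < n]]) ->
    ~ sat phi [tuple of a :: [tuple fs i k | i < n]].
  move=> k; have [?|/existsNP[a na]] := pselect (forall a, sat phi [tuple of a :: [tuple fs i k | i < n]]).
    by exists pt.
  by exists a.
have /E Uf := H (to_ultra f).
have [k [/= nk]] := ultra_ex (ultraI nU Uf).
exact: fP.
Qed.

Lemma ultrapower_models (T : theory L) : models M T -> models ultrapower T.
Proof.
move=> MT phi Tphi.
have := los phi (fun i => match notF (ltn_ord i) with end).
rewrite [mktuple _]tuple0 => ->; apply: ultraE => k /=.
by rewrite [mktuple _]tuple0; apply: MT.
Qed.

(** The same formula serves, each parameter being replaced by the germ of its constant sequence. *)
Lemma def_pred_ultra V (P : (V -> M) -> Prop) : def_pred P ->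
  exists P' : (V -> ultrapower) -> Prop, def_pred P' /\
    forall e : V -> nat -> M,
      P' (fun x => to_ultra (e x)) <-> U [set k | P (fun x => e x k)].
Proof.
move=> [m [phi [v H]]].
pose v' i : V + ultrapower := match v i with inl x => inl x | inr a => inr (to_ultra (fun=> a)) end.
exists (fun e => sat phi [tuple assign e (v' i) | i < m]); split; first by exists m, phi, v'.
move=> e.
pose fs i k := assign (fun x => e x k) (v i).
rewrite (_ : mktuple _ = [tuple to_ultra (fs i) | i < m]); last first.
  by apply: eq_from_tnth => i; rewrite !tnth_mktuple /v' /fs; case: (v i).
rewrite los; set S := mkset _; set S' := mkset _; suff -> : S = S' by [].
by apply/seteqP; split=> k; rewrite /S /S' /= H.
Qed.

(** * Transfer of coordinatised sets to the ultrapower *)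

Section GroupUltrapower.
Variables (A : Type) (n : nat) (q : A -> n.-tuple M).
Hypothesis range_q : definable (range q).

Definition uq (a : nat -> A) : n.-tuple ultrapower :=
  [tuple to_ultra (fun k => tnth (q (a k)) j) | j < n].

Lemma uqP a b : uq a = uq b <-> U [set k | q (a k) = q (b k)].
Proof.
split=> [ab|ab].
  have : U [set k | forall j, tnth (q (a k)) j = tnth (q (b k)) j].
    apply: (@ultra_fin_all _ (fun j => [set k | tnth (q (a k)) j = tnth (q (b k)) j])) => j.
    by have := congr1 (fun t => tnth t j) ab; rewrite !tnth_mktuple => /to_ultraP.
  by apply: ultraS => k H; apply: eq_from_tnth.
apply: eq_from_tnth => j; rewrite !tnth_mktuple; apply/to_ultraP.
by apply: ultraS ab => k /= ->.
Qed.

(** Variables can afterwards be fixed to sequences by [gdef_subst]; so sets whose parameter depends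
    on [k] become definable in the ultrapower. *)
Lemma gdef_ultra V (R : (V -> A) -> Prop) : gdef q R ->
  gdef uq (fun e : V -> nat -> A => U [set k | R (fun x => e x k)]).
Proof.
move=> [P [/def_pred_ultra[P' [HP' H']] H]]; exists P'; split=> // e.
rewrite (_ : (fun _ => _) = fun vj => to_ultra (fun k => tnth (q (e vj.1 k)) vj.2)); last first.
  by apply/funext => vj; rewrite tnth_mktuple.
rewrite H'; set S := mkset _; set S' := mkset _; suff -> : S = S' by [].
by apply/seteqP; split=> k; rewrite /S /S' /= H.
Qed.

Lemma definable_range_ultra : definable (range uq).
Proof.
have [P' [HP' H']] := def_pred_ultra (definable_def range_q).
apply: def_definable; apply: def_ext HP' => e.
have [pt] := carrier_inhabited M.
pose f i := of_ultra (e i).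
have -> : e = fun i => to_ultra (f i) by apply/funext => i; rewrite /f of_ultraK.
rewrite H'; split=> [UH|[a _ ae]].
  have [k0 [a0 _ _]] := ultra_ex UH.
  (* Preimages under [q] are chosen factor by factor, with [a0] as default where the tuple is
     outside the range. *)
  have /choice[a aP] : forall k, exists a, range q [tuple f i k | i < n] -> q a = [tuple f i k | i < n].
    move=> k; have [[a _ <-]|nr] := pselect (range q [tuple f i k | i < n]); first by exists a.
    by exists a0.
  exists a => //; apply: eq_from_tnth => i; rewrite !tnth_mktuple; apply/to_ultraP.
  by apply: ultraS UH => k /aP /= ->; rewrite tnth_mktuple.
have : U [set k | forall i, tnth (q (a k)) i = f i k].
  apply: (@ultra_fin_all _ (fun i => [set k | tnth (q (a k)) i = f i k])) => i.
  by have := congr1 (fun t => tnth t i) ae; rewrite !tnth_mktuple => /to_ultraP.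
apply: ultraS => k H; exists (a k) => //; apply: eq_from_tnth => i.
by rewrite tnth_mktuple H.
Qed.

End GroupUltrapower.
End Ultrapower.

Lemma nonprincipal_ultrafilter : exists U : set_system nat,
  UltraFilter U /\ forall m, U [set k | (m <= k)%N].
Proof.
have [U [UF sU]] := @ultraFilterLemma nat \oo _; exists U; split=> // m.
by apply: sU; exists m.
Qed.

(** * Dimension as a rank on definable subgroups *)

Section Dimension.
Variables (L : language) (T : theory L).
Variable dim : forall (M : structure L) n, set (set (n.-tuple M)) -> dimension.
Hypothesis dimP : dimension_function T dim.
Variables (M : structure L) (hM : models M T).
Variables (A : zmodType) (n : nat) (q : A -> n.-tuple M).
Hypothesis range_q : definable (range q).
Hypothesis q_sub : forall V (x y z : V), gdef q (fun e => q (e x - e y) = q (e z)).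
Implicit Types X Y Z : set A.

Lemma q_sub_param V (x y z : V + A) :
  gdef q (fun e => q (assign e x - assign e y) = q (assign e z)).
Proof.
exact: (gdef_subst (fun o : option bool => match o with
  | None => x | Some true => y | Some false => z end)
  (q_sub None (Some true) (Some false))).
Qed.

(** A definable relation sees its arguments only through [q], and the graph of subtraction is
    definable. *)
Lemma q_subl a b y : q a = q b -> q (a - y) = q (b - y).
Proof.
move=> ab; symmetry.
exact: (gdef_saturated (e := fun=> a) (e' := fun=> b)
  (@q_sub_param unit (inl tt) (inr y) (inr (a - y)))).
Qed.

Lemma gdef_sub V X (x y : V + A) : gset q X -> gdef q (fun e => X (assign e x - assign e y)).
Proof.
move=> HX.
pose w (z : V + A) : option V + A := match z with inl v => inl (Some v) | inr a => inr a end.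
apply: gdef_ext (gdef_ex range_q (R := fun e d => X d /\ q (assign e x - assign e y) = q d) _).
  move=> e; split=> [[d [Xd E]]|Xd]; last by exists (assign e x - assign e y).
  by apply: gset_saturated HX _ Xd; rewrite E.
apply: gdef_and; first exact: gdef_gset.
apply: gdef_ext (@q_sub_param _ (w x) (w y) (inl None)) => e.
by case: x y => [x|x] [y|y].
Qed.

Definition singletons X : set (set (n.-tuple M)) := [set [set q x] | x in X].

Lemma interpretable_singletons X : gset q X -> interpretable (singletons X).
Proof.
move=> HX; rewrite (_ : singletons X = quotient_set (q @` X) eq).
  apply: interpretable_quotient; first exact: gset_def.
    apply: def_ext (def_fin_all (fun j => def_eq M (inl j) (inr j))) => e.
    split=> [H|H j]; first by apply: eq_from_tnth => i; rewrite !tnth_mktuple.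
    by have := congr1 (fun t => tnth t j) H; rewrite !tnth_mktuple.
  by split=> // x y z _ _ _ -> ->.
rewrite /singletons /quotient_set image_comp; apply: eq_imagel => x Xx /=.
by apply/seteqP; split=> t /= => [->|[]//]; split=> //; exists x.
Qed.

Lemma dim_mono X Y : gset q X -> gset q Y -> X `<=` Y ->
  dim_le (dim (singletons X)) (dim (singletons Y)).
Proof.
move=> HX HY XY.
have U : singletons X `|` singletons Y = singletons Y.
  by apply/setUidPr => _ [x Xx <-]; exists x => //; apply: XY.
have := dim_union dimP hM (interpretable_singletons HX) (interpretable_singletons HY).
rewrite U => /(_ (interpretable_singletons HY)).
case: (dim (singletons X)) => [a|] //; case: (dim (singletons Y)) => [b|] //= [->].
exact: leq_maxl.
Qed.

(** [X] contains the fibre of [q] through [a], which yields a single singleton and so has dimension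
    0; monotonicity excludes -oo for [X]. *)
Lemma dim_nonempty X a : gset q X -> X a -> exists k, dim (singletons X) = Some k.
Proof.
move=> HX Xa; pose Z := [set b | q b = q a].
have HZ : gset q Z.
  apply: gdef_ext (@q_sub_param unit (inl tt) (inr 0) (inr a)) => e /=.
  by rewrite subr0.
have : dim_le (dim (singletons Z)) (dim (singletons X)).
  by apply: dim_mono => // b /esym qb; apply: gset_saturated HX qb Xa.
have /(dim_finite dimP hM (interpretable_singletons HZ)) -> :
    finite_set (singletons Z) /\ singletons Z !=set0.
  split; last by exists [set q a], a.
  apply: (@sub_finite_set _ _ [set [set q a]]); last exact: finite_set1.
  by move=> _ [b -> <-].
by case: (dim (singletons X)) => // k _; exists k.
Qed.

(** Upper Fibration with [k = 0] for the map a |-> a - y, whose fibres are nonempty. The reverse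
    inequality comes from translating back, in [dim_coset]. *)
Lemma dim_translate Z y : gset q Z ->
  dim_le (dim (singletons [set b | Z (b + y)])) (dim (singletons Z)).
Proof.
move=> HZ; set Z' := mkset _.
have HZ' : gset q Z'.
  apply: gdef_ext (@gdef_sub unit Z (inl tt) (inr (- y)) HZ) => e /=.
  by rewrite opprK.
pose R a b := Z a /\ q (a - y) = q b.
pose f (u : set (n.-tuple M)) : set (n.-tuple M) :=
  [set t | exists a, [/\ Z a, u (q a) & t = q (a - y)]].
have fE a : Z a -> f [set q a] = [set q (a - y)].
  move=> Za; apply/seteqP; split=> t /=.
    by move=> [b [_ ba ->]]; apply: q_subl.
  by move=> ->; exists a.
have HR : gdef q (fun e : bool -> A => R (e true) (e false)).
  apply: gdef_and; first exact: gdef_gset.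
  exact: (@q_sub_param bool (inl true) (inr y) (inl false)).
have fdef : interpretable_fun (singletons Z) (singletons Z') f.
  split; first by move=> _ [a Za <-]; rewrite fE //; exists (a - y); rewrite // /Z' /= subrK.
  have := gdef_definable_rel range_q HR; congr definable.
  congr image; apply/funext => -[t u]; apply/propext; split=> /=.
    move=> [a [b [-> -> [Za <-]]]]; exists [set q a]; split=> //; first by exists a.
    by rewrite fE.
  move=> [_ [[a Za <-] -> ]]; rewrite fE // => ->.
  by exists a, (a - y).
have := @dim_upper_fibration _ _ _ dimP M hM _ _ _ _ _ 0 (interpretable_singletons HZ) (interpretable_singletons HZ') fdef.
have -> : dim_add (dim (singletons Z')) 0 = dim (singletons Z').
  by case: (dim _) => //= k; rewrite addn0.
apply; move=> _ [b Zb <-].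
pose F := [set a | R a b].
have HF : gset q F.
  apply: gdef_and; first exact: gdef_gset.
  exact: (@q_sub_param unit (inl tt) (inr y) (inr b)).
have -> : singletons Z `&` f @^-1` [set [set q b]] = singletons F.
  apply/seteqP; split=> u.
    move=> [[a Za <-]]; rewrite /preimage /= fE // => E; exists a => //; split=> //.
    by have : [set q b] (q (a - y)) by rewrite -E.
  move=> [a [Za ab] <-]; split; first by exists a.
  by rewrite /preimage /= fE // ab.
have [|k ->] := dim_nonempty (a := b + y) HF; last by [].
by split; rewrite ?addrK.
Qed.

(** * Dimension and the index of definable subgroups *)

Section Quotient.
Variables X Y : set A.
Hypothesis HX : gset q X.
Hypothesis HY : gset q Y.
Hypothesis X_subgroup : subgroup X.
Hypothesis Y_subgroup : subgroup Y.
Hypothesis XY : X `<=` Y.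

Definition congr_mod a b : Prop := [/\ Y a, Y b & X (a - b)].

Let congr_def : gdef q (fun e : bool -> A => congr_mod (e true) (e false)).
Proof.
apply: gdef_ext (gdef_and (gdef_gset true HY) (gdef_and (gdef_gset false HY)
  (@gdef_sub bool X (inl true) (inl false) HX))) => e.
by split=> [[? []]|[]].
Qed.

Let cls a : set (n.-tuple M) := tuple_rel q congr_mod (q a).

Let clsP a b : cls a (q b) <-> congr_mod a b.
Proof.
split=> [[a' [b' [aa' bb' H]]]|H]; last by exists a, b.
apply: (gdef_saturated (e := fun o : bool => if o then a' else b')
  (e' := fun o : bool => if o then a else b) congr_def) => // -[] //.
Qed.

Let cls_eq a b : Y a -> Y b -> cls a = cls b <-> X (a - b).
Proof.
move=> Ya Yb; split=> [E|Xab].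
  have /clsP[_ _] : cls b (q a) by rewrite -E; apply/clsP; split=> //; rewrite subrr; case: X_subgroup.
  by rewrite -opprB => /(subgroupN X_subgroup); rewrite opprK.
apply/seteqP; split=> t H; have [a' [c [_ tE _]]] := H; move: H; rewrite tE => /clsP[_ Yc Xc];
  apply/clsP; split=> //.
  by rewrite -(subrKA a); apply: subgroupD => //; rewrite -opprB; apply: subgroupN.
by rewrite -(subrKA b); apply: subgroupD.
Qed.

Definition cosets : set (set (n.-tuple M)) :=
  quotient_set (q @` Y) (tuple_rel q congr_mod).

Let cosetsE : cosets = [set cls a | a in Y].
Proof.
rewrite /cosets /quotient_set image_comp; apply: eq_imagel => a Ya /=.
apply/seteqP; split=> t [] //.
by move=> a' [b [aa' tE [Ya' Yb Xab]]]; split; [exists b|exists a', b].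
Qed.

Lemma interpretable_cosets : interpretable cosets.
Proof.
apply: interpretable_quotient; [exact: gset_def|exact: gdef_tuple_rel|].
split.
- by move=> _ [a Ya <-]; apply/clsP; split=> //; rewrite subrr; case: X_subgroup.
- move=> _ _ [a Ya <-] [b Yb <-] /clsP[_ _ Xab]; apply/clsP; split=> //.
  by rewrite -opprB; apply: subgroupN.
move=> _ _ _ [a Ya <-] [b Yb <-] [c Yc <-] /clsP[_ _ Xab] /clsP[_ _ Xbc].
by apply/clsP; split=> //; rewrite -(subrKA b); apply: subgroupD.
Qed.

Let proj (u : set (n.-tuple M)) : set (n.-tuple M) :=
  [set t | exists s, u s /\ tuple_rel q congr_mod s t].

Let projE a : proj [set q a] = cls a.
Proof. by apply/seteqP; split=> t => [[s [-> ]]|H] //; exists (q a). Qed.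

Let proj_fun : interpretable_fun (singletons Y) cosets proj.
Proof.
split; first by move=> _ [a Ya <-]; rewrite projE cosetsE; exists a.
have := gdef_definable_rel range_q congr_def; congr definable.
congr image; apply/funext => -[t u]; apply/propext; split=> /=.
  move=> [a [b [-> -> H]]]; exists [set q a]; split=> //; first by exists a; case: H.
  by rewrite projE; apply/clsP.
by move=> [_ [[a Ya <-] ->]]; rewrite projE.
Qed.

Let fibre y : Y y ->
  singletons Y `&` proj @^-1` [set cls y] = singletons [set b | X (b - y)].
Proof.
move=> Yy; apply/seteqP; split=> u.
  move=> [[a Ya <-]]; rewrite /preimage /= projE => E; exists a => //=.
  by apply/cls_eq.
move=> [a Xay <-]; have Ya : Y a by rewrite -(subrK y a); apply: subgroupD => //; apply: XY.
by split; [exists a|rewrite /preimage /= projE; apply/cls_eq].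
Qed.

Let dim_coset y : dim (singletons [set b | X (b - y)]) = dim (singletons X).
Proof.
have H1 := dim_translate (- y) HX.
have HXy : gset q [set b | X (b - y)] by exact: (@gdef_sub unit X (inl tt) (inr y) HX).
have H2 := dim_translate y HXy; rewrite /= in H2.
move: H1 H2; rewrite (_ : [set b | X (b + y - y)] = X); last first.
  by apply/seteqP; split=> b /=; rewrite addrK.
case: (dim (singletons X)) => [a|]; case: (dim _) => [b|] //= ab ba.
by congr Some; apply/eqP; rewrite eqn_leq ab.
Qed.

(** [Y] fibres over Y/X with translates of [X] as fibres. The dimension of Y/X is not 0, as Y/X is
    infinite, nor -oo, by Lower Fibration; so it is at least 1, and Upper Fibration gives the strict
    inequality. *)
Lemma dim_lt_infinite_index k : dim (singletons X) = Some k -> ~ acont Y X ->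
  exists2 l, dim (singletons Y) = Some l & (k < l)%N.
Proof.
move=> dX nYX.
have [l dY] := dim_nonempty HY (subgroup0 Y_subgroup); exists l => //.
have fd v : cosets v -> dim (singletons Y `&` proj @^-1` [set v]) = Some k.
  by rewrite cosetsE => -[y Yy <-]; rewrite fibre // dim_coset.
have := @dim_upper_fibration _ _ _ dimP M hM _ _ _ _ _ k (interpretable_singletons HY) interpretable_cosets proj_fun.
have := @dim_lower_fibration _ _ _ dimP M hM _ _ _ _ _ k (interpretable_singletons HY) interpretable_cosets proj_fun.
rewrite dY; case dC : (dim cosets) => [[|m]|] //=.
- move=> _ _; case: nYX.
  have [/finite_seqP[s sE] _] := (dim_finite dimP hM interpretable_cosets).1 dC.
  apply: (@acont_key _ _ (fun C a => cls a = C) s).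
    move=> a Ya; exists (cls a) => //.
    by have : cosets (cls a); [rewrite cosetsE; exists a|rewrite sE].
  by move=> C a b Ya Yb <- /esym/cls_eq; apply.
- move=> _ H; apply: (@leq_trans (m.+1 + k)%N); first by rewrite addSn ltnS leq_addl.
  by apply: H => v /fd -> /=.
- by move=> H; exfalso; apply: H => v /fd -> /=.
Qed.

Lemma dim_le_finite_index k : dim (singletons X) = Some k -> acont Y X ->
  exists2 l, dim (singletons Y) = Some l & (l <= k)%N.
Proof.
move=> dX [s sP].
have [l dY] := dim_nonempty HY (subgroup0 Y_subgroup); exists l => //.
have := @dim_lower_fibration _ _ _ dimP M hM _ _ _ _ _ k (interpretable_singletons HY) interpretable_cosets proj_fun.
have /(dim_finite dimP hM interpretable_cosets) -> : finite_set cosets /\ cosets !=set0.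
  split; last by exists (cls 0); rewrite cosetsE; exists 0 => //; case: Y_subgroup.
  (* The translating elements [x] need not lie in [Y], so the cosets are listed as the traces on [Y]
     of the translates of [X]. *)
  pose C x : set (n.-tuple M) := [set t | exists b, [/\ Y b, t = q b & X (b - x)]].
  apply: (@sub_finite_set _ _ (C @` [set` s])); last by apply: finite_image; apply/finite_seqP; exists s.
  rewrite cosetsE => _ [a Ya <-]; have [x xs Xax] := sP a Ya; exists x => //.
  apply/seteqP; split=> [_ [b [Yb -> Xbx]]|t H].
    apply/clsP; split=> //; rewrite -(subrKA x) -[x - b]opprB; exact: subgroupB.
  have [a' [c [_ tE _]]] := H; move: H; rewrite tE => /clsP[_ Yc Xc]; exists c; split=> //.
  by rewrite -(subrKA a); apply: subgroupD => //; rewrite -opprB; apply: subgroupN.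
rewrite dY /= ?add0n; apply; rewrite cosetsE => _ [y Yy <-].
by rewrite fibre // dim_coset dX /=.
Qed.

End Quotient.

(** The default 0 never arises for definable subgroups, which are nonempty. *)
Definition rank X : nat := odflt 0%N (dim (singletons X)).

Lemma rank_mono X Y : gset q X -> gset q Y -> X `<=` Y -> (rank X <= rank Y)%N.
Proof.
move=> HX HY XY; have := dim_mono HX HY XY; rewrite /rank.
by case: (dim (singletons X)) => // a; case: (dim (singletons Y)).
Qed.

Lemma rank_infinite_index X Y : gset q X -> gset q Y -> subgroup X -> subgroup Y ->
  X `<=` Y -> ~ acont Y X -> (rank X < rank Y)%N.
Proof.
move=> HX HY X_subgroup Y_subgroup XY nYX.
have [k dX] := dim_nonempty HX (subgroup0 X_subgroup).
have [l dY kl] := dim_lt_infinite_index HX HY X_subgroup Y_subgroup XY dX nYX.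
by rewrite /rank dX dY.
Qed.

Lemma rank_finite_index X Y : gset q X -> gset q Y -> subgroup X -> subgroup Y ->
  X `<=` Y -> acont Y X -> (rank Y <= rank X)%N.
Proof.
move=> HX HY X_subgroup Y_subgroup XY YX.
have [k dX] := dim_nonempty HX (subgroup0 X_subgroup).
have [l dY kl] := dim_le_finite_index HX HY X_subgroup Y_subgroup XY dX YX.
by rewrite /rank dX dY.
Qed.

Lemma gsetI X Y : gset q X -> gset q Y -> gset q (X `&` Y).
Proof. exact: gdef_and. Qed.

Lemma rank_acont X Y : gset q X -> gset q Y -> subgroup X -> subgroup Y ->
  acont X Y -> (rank X <= rank Y)%N.
Proof.
move=> HX HY X_subgroup Y_subgroup XaY.
apply: (@leq_trans (rank (X `&` Y))).
  apply: rank_finite_index => //; [exact: gsetI|exact: subgroupI|exact: acont_self].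
by apply: rank_mono => //; exact: gsetI.
Qed.

(** Otherwise the intersection, of finite index in [X], would have infinite index in [Y], and the
    rank of [Y] would exceed that of [X]. *)
Lemma acont_rank X Y : gset q X -> gset q Y -> subgroup X -> subgroup Y ->
  acont X Y -> (rank Y <= rank X)%N -> acont Y X.
Proof.
move=> HX HY X_subgroup Y_subgroup XaY; apply: contraPP => nYX.
apply/negP; rewrite -ltnNge; apply: (@leq_ltn_trans (rank (X `&` Y))).
  apply: rank_finite_index => //; [exact: gsetI|exact: subgroupI|exact: acont_self].
apply: rank_infinite_index => //; [exact: gsetI|exact: subgroupI|].
by move=> H; apply: nYX; apply: acont_trans H _; apply: acont_sub => x [].
Qed.

End Dimension.

(** * Uniform bounds on finite indices *)

Section UniformIndex.
Variables (L : language) (T : theory L).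
Variable dim : forall (M : structure L) n, set (set (n.-tuple M)) -> dimension.
Hypothesis dimP : dimension_function T dim.
Variables (M : structure L) (hM : models M T).
Variables (A : zmodType) (n : nat) (q : A -> n.-tuple M).
Hypothesis range_q : definable (range q).
Hypothesis q_sub : forall V (x y z : V), gdef q (fun e => q (e x - e y) = q (e z)).

(** If every finite intersection of [W] with subgroups [S h] fails as [W'] for every bound, then for
    each [d] one picks [h] repeatedly so that each new [S h] has index above [d] in the intersection
    so far. In an ultrapower along [d] these chains become one infinite chain of definable subgroups
    with infinite successive indices. *)
Lemma uniform_index_bound (W N : set A) (S : A -> set A) :
  gset q W -> subgroup W ->
  gdef q (fun e : bool -> A => S (e true) (e false)) ->
  (forall h, subgroup (S h)) ->
  (forall h, N h -> acont W (S h)) ->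
  exists W' d, [/\ subgroup W', W' `<=` W, acont W W' &
    forall h, N h -> index_le d (S h) W'].
Proof.
move=> W_def W_subgroup S_def S_subgroup WS; apply: contrapT => nbound.
pose Wl (l : seq A) := W `&` [set w | forall h, h \in l -> S h w].
have WlS h l : Wl (h :: l) = Wl l `&` S h.
  apply/seteqP; split=> w.
    move=> [Ww Sw]; split; last by apply: Sw; rewrite mem_head.
    by split=> // k kl; apply: Sw; rewrite inE kl orbT.
  by move=> [[Ww Sw] Shw]; split=> // k; rewrite inE => /orP[/eqP->|/Sw].
have Wl_subgroup l : subgroup (Wl l).
  elim: l => [|h l IH]; last by rewrite WlS; apply: subgroupI.
  by rewrite (_ : Wl _ = W) //; apply/seteqP; split=> w // [].
have Wl_acont l : (forall h, h \in l -> N h) -> acont W (Wl l).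
  elim: l => [_|h l IH lN]; first by apply: acont_sub => w Ww; split.
  rewrite WlS; apply: acontI => //; last by apply: WS; apply: lN; rewrite mem_head.
  by apply: IH => k kl; apply: lN; rewrite inE kl orbT.
have /choice[pick pickP] : forall dl : nat * seq A, exists h,
    (forall h, h \in dl.2 -> N h) -> N h /\ ~ index_le dl.1 (S h) (Wl dl.2).
  move=> [d l] /=; have [lN|nlN] := pselect (forall h, h \in l -> N h); last by exists 0.
  apply: contrapT => nex; apply: nbound; exists (Wl l), d; split=> //; first by move=> w [].
    exact: Wl_acont.
  by move=> h Nh; apply: contrapT => nidx; apply: nex; exists h.
pose hs d := fix hs j := if j is k.+1 then pick (d, hs k) :: hs k else [::].
have hsN d j h : h \in hs d j -> N h.
  elim: j h => // j IH h; rewrite inE => /orP[/eqP->|/IH//].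
  by have [] := pickP (d, hs d j) IH.
pose hd d j := pick (d, hs d j).
pose Wd d j := Wl (hs d j).
(* Witnesses that the index exceeds [d] at stage [j]: [d.+1] elements pairwise incongruent modulo
   the next subgroup. *)
have /choice[x xP] : forall dj : nat * nat, exists x : nat -> A, (forall a, Wd dj.1 dj.2 (x a)) /\
    forall a b, (a < b)%N -> (b <= dj.1)%N -> ~ S (hd dj.1 dj.2) (x b - x a).
  move=> [d j] /=; have [_ /existsNP[x /not_implyP[Wx nx]]] := pickP (d, hs d j) (@hsN d j).
  by exists x; split=> // a b ab bd Sx; apply: nx; exists a, b.
have [U [UF Uinf]] := nonprincipal_ultrafilter.
pose uA := nat -> A.
(* The factor [k] carries the chain built for the bound [k], so the bound tends to infinity along
   the nonprincipal [U]. *)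
pose Wu j : set uA := [set w | U [set k | Wd k j (w k)]].
have Wu_subgroup j : subgroup (Wu j).
  split; first by apply: ultraE => k; exact: (subgroup0 (Wl_subgroup _)).
  by move=> v w Wv Ww; apply: ultraS (ultraI Wv Ww) => k [Wvk Wwk]; exact: (subgroupB (Wl_subgroup _) Wvk Wwk).
have WuS j : Wu j.+1 = Wu j `&` [set w | U [set k | S (hd k j) (w k)]].
  apply/seteqP; split=> w.
    by move=> Ww; split; apply: ultraS Ww => k /=; rewrite /Wd /= WlS => -[].
  by move=> [Ww Sw]; apply: ultraS (ultraI Ww Sw) => k [] /=; rewrite /Wd /= WlS.
have Wu_def j : gset (uq U q) (Wu j).
  elim: j => [|j IH].
    apply: gdef_ext (gdef_ultra (UF := UF) W_def) => e.
    by split=> H; apply: ultraS H => k; rewrite /Wd /Wl /=; [split|case].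
  rewrite WuS; apply: gdef_and => //.
  exact: (gdef_subst (fun b : bool => if b then inr (fun k => hd k j) else inl tt)
    (gdef_ultra (UF := UF) S_def)).
have Wu_index j : ~ acont (Wu j) (Wu j.+1).
  move=> /(acont_index_le (Wu_subgroup j.+1))[d idx].
  (* For [a < b], the sequences [y a] and [y b] are incongruent in every factor [k >= b], hence in
     [U]-almost all factors; this gives infinitely many cosets. *)
  pose y a k := if (a <= k)%N then x (k, j) a else 0.
  have [a|a [b [ab _]]] := idx y.
    by apply: ultraE => k /=; rewrite /y; case: ifP => _; [exact: (proj1 (xP (k, j)) a)|exact: (subgroup0 (Wl_subgroup _))].
  rewrite WuS => -[_ /= Sy]; have [k [/= Sk bk]] := ultra_ex (ultraI Sy (Uinf b)).
  have [_ /(_ a b ab bk)] := xP (k, j); apply; move: Sk.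
  by rewrite /y !fctE bk (leq_trans (ltnW ab) bk).
have uq_sub V (v w z : V) : gdef (uq U q) (fun e => uq U q (e v - e w) = uq U q (e z)).
  apply: gdef_ext (gdef_ultra (UF := UF) (q_sub v w z)) => e.
  by rewrite uqP.
pose r j := rank dim (uq U q) (Wu j).
have rlt j : (r j.+1 < r j)%N.
  apply: (rank_infinite_index dimP (ultrapower_models hM)) => //.
    exact: definable_range_ultra.
  by rewrite WuS => w [].
have rle j : (r j + j <= r 0)%N.
  elim: j => [|j IH]; first by rewrite addn0.
  by apply: leq_trans IH; rewrite addnS -addSn leq_add2r.
by have := leq_trans (leq_addl _ _) (rle (r 0%N).+1); rewrite ltnn.
Qed.

End UniformIndex.

(** * The Frattini argument applied to definable subgroups *)

Theorem corollary1p5 (L : language) (T : theory L) (hT : finite_dimensional T)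
  (M : structure L) (hM : models M T)
  (g : lieRingType) (n : nat) (iota : g -> n.-tuple M)
  (hg : definable_lie_ring iota)
  (i c : set g)
  (hi : ideal_of [set: g] i) (hi_def : definable (iota @` i))
  (hc : almost_cartan i c) (hc_def : definable (iota @` c)) :
  commensurable [set: g]
    [set x + y | x in i & y in almost_normaliser [set: g] c].
Proof.
have [dim dimP] := hT; have [iota_inj range_iota add_def bracket_def] := hg.
have [c_sub_i c_subring [N [[N_subgroup N_subring] N_nil N_index]] norm_index] := hc.
have [_ i_subgroup _] := hi; have c_subgroup := proj1 c_subring.
have graph V (f : g -> g -> g) (x y z : V) :
    definable [set [tuple of iota xy.1 ++ [tuple of iota xy.2 ++ iota (f xy.1 xy.2)]] | xy in [set: g * g]] ->
    gdef iota (fun e : V -> g => f (e x) (e y) = e z).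
  move=> f_def; apply: gdef_ext (gdef_graph x y z _ f_def) => [e|a a' b b' /iota_inj -> /iota_inj ->] //.
  by split=> [/iota_inj|->].
have sub_def V (x y z : V) : gdef iota (fun e => iota (e x - e y) = iota (e z)).
  (* Subtraction is read off the graph of addition: x - y = z means z + y = x. *)
  apply: gdef_ext (graph V +%R z y x add_def) => e.
  by split=> [<-|/iota_inj <-]; rewrite ?addrK ?subrK.
have gset_iota X : definable (iota @` X) -> gset iota X.
  by apply: gset_of_definable => a b /iota_inj ->.
have i_def := gset_iota i hi_def.
have c_def := gset_iota c hc_def.
pose D H := subgroup H /\ gset iota H.
have DI H K : D H -> D K -> D (H `&` K).
  by move=> [? ?] [? ?]; split; [exact: subgroupI|exact: gdef_and].
have bracket_preimage K : gset iota K ->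
    gdef iota (fun e : bool -> g => K (bracket (e true) (e false))).
  move=> HK; apply: gdef_ext (gdef_ex range_iota (R := fun e y => K y /\ bracket (e true) (e false) = y) _).
    by move=> e; split=> [[y [Ky ->]]|Ke] //; exists (bracket (e true) (e false)).
  by apply: gdef_and; [exact: gdef_gset|exact: (graph _ bracket)].
have sum_acont : acont setT (sumset i (almost_normaliser setT c)).
  apply: (@frattini_argument g i c N D (rank dim iota)) => //.
  - by move=> H [].
  - by split=> //; exact: gdef_True.
  - split; first by split=> [|x y /= -> ->]; rewrite ?subrr.
    (* Zero is defined by the equation x + x = x. *)
    apply: gdef_ext (graph unit +%R tt tt tt add_def) => e.
    by split=> [/(canRL (addrK _))|/= ->]; rewrite ?subrr ?addr0.
  - move=> H K [HH H_def] [HK K_def]; split; first exact: subgroup_sum.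
    apply: gdef_ext (gdef_ex range_iota (R := fun e x => exists y, [/\ H x, K y & x + y = e tt]) _).
      by move=> e; split=> [[x [y [Hx Ky <-]]]|[x Hx [y Ky xy]]]; [exists x => //; exists y|exists x, y].
    apply: (gdef_ex range_iota (R := fun e y => [/\ H (e None), K y & e None + y = e (Some tt)])).
    apply: gdef_ext (gdef_and (gdef_gset (Some None) H_def) (gdef_and (gdef_gset None K_def)
      (graph _ +%R (Some None) None (Some (Some tt)) add_def))) => e.
    by split=> [[? []]|[]].
  - move=> x H [HH H_def]; split; first by apply: subgroup_image => //; apply: bracketBr.
    apply: gdef_ext (gdef_ex range_iota (R := fun e y => H y /\ bracket x y = e tt) _).
      by move=> e; split=> [[y [Hy <-]]|[y Hy yE]]; exists y.
    apply: gdef_and; first exact: gdef_gset.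
    exact: (gdef_subst (fun o : option bool => match o with
      | None => inr x | Some true => inl None | Some false => inl (Some tt) end)
      (graph _ bracket None (Some true) (Some false) bracket_def)).
  - move=> x H [HH H_def]; split; first by apply: subgroup_preimage => //; apply: bracketBr.
    exact: (gdef_subst (fun b : bool => if b then inr x else inl tt) (bracket_preimage H H_def)).
  - by move=> H K [HH H_def] [HK K_def]; exact: (rank_acont dimP hM range_iota sub_def H_def K_def HH HK).
  - by move=> H K [HH H_def] [HK K_def]; exact: (acont_rank dimP hM range_iota sub_def H_def K_def HH HK).
  - move=> W [HW W_def] WN.
    apply: (uniform_index_bound dimP hM range_iota) => //; first exact: bracket_preimage.
    by move=> h; apply: subgroup_preimage => //; apply: bracketBr.
  - by case: N_index.
  - by apply: finite_index_acont N_index; case: N_subgroup.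
  - by apply: finite_index_acont norm_index; case: c_subgroup.
(* The almost normaliser is shown to be a subgroup, so that [almost_containedP] can turn [sum_acont]
   into commensurability. *)
have normaliserB x y : almost_normaliser setT c x -> almost_normaliser setT c y ->
    almost_normaliser setT c (x - y).
  have H z : subgroup [set bracket z h | h in c] by apply: subgroup_image => //; apply: bracketBr.
  move=> [_ /(almost_containedP (H x) c_subgroup) xc] [_ /(almost_containedP (H y) c_subgroup) yc].
  split=> //; apply/almost_containedP => //.
  apply: (@acont_trans _ _ (sumset [set bracket x h | h in c] [set bracket y h | h in c])).
    apply: acont_sub => _ [h ch <-]; rewrite bracketBl; exists (bracket x h); first by exists h.
    exists (- bracket y h) => //; rewrite -bracketxN; exists (- h) => //.
    exact: subgroupN.
  exact: acont_sum.
have normaliser_subgroup : subgroup (almost_normaliser setT c).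
  split=> //; split=> //; apply/almost_containedP => //.
    by apply: subgroup_image => //; apply: bracketBr.
  by apply: acont_sub => _ [h ch <-]; rewrite bracket0x; apply: subgroup0.
have sum_subgroup : subgroup (sumset i (almost_normaliser setT c)) by apply: subgroup_sum.
split; apply/almost_containedP => //; exact: acont_sub.
Qed.
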